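(* Let $T>0$ and let $T_{l,e}:\mathcal{H}^{-1/2}(\Omega)\to\mathcal{H}^{-1/2}(\Omega)$ be the linear operator $T_{l,e}\varphi:=\tanh(AT)^2\varphi$. Then $T_{l,e}$ is positive, self-adjoint, injective, regular asymptotic in $\mathcal{H}^{-1/2}(\Omega)$ and non-expansive, and $1\notin\sigma_p(T_{l,e})$, i.e. $1$ is not an eigenvalue of $T_{l,e}$.
   Context: Let $\Omega\subset\mathbb{R}^n$ be an open, bounded set with smooth boundary and let $A$ be a positive ($\langle A\varphi,\varphi\rangle>0$ for $0\neq\varphi$ in the domain of $A$), self-adjoint, unbounded operator with discrete spectrum, densely defined on the Hilbert space $H:=L^2(\Omega)$. Let $E_\lambda$, $\lambda\in\mathbb{R}$, denote the resolution of the identity associated to $A$. For $s\ge 0$ set $\mathcal{H}^s(\Omega):=\{\varphi\in H : \|\varphi\|_s:=(\int_0^\infty(1+\lambda^2)^s\,d\langle E_\lambda\varphi,\varphi\rangle)^{1/2}<\infty\}$. For $s>0$, $\mathcal{H}^{-s}(\Omega)$ is the dual of $\mathcal{H}^s(\Omega)$ (with pivot space $H$); equivalently, it is the completion of $H$ in the norm $\|\varphi\|_{-s}:=(\int_0^\infty(1+\lambda^2)^{-s}\,d\langle E_\lambda\varphi,\varphi\rangle)^{1/2}$, and it is a Hilbert space with the corresponding inner product. Functions of $A$ such as $\tanh(AT)$ are defined by the spectral calculus of $A$ (extended to the spaces $\mathcal{H}^{s}(\Omega)$). A linear operator $S$ on a Hilbert space $X$ is non-expansive if $\|S\|\le 1$,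 and it is regular asymptotic in $X$ if $\|S^{k+1}x-S^kx\|\to 0$ as $k\to\infty$ for every $x\in X$. *)

(* Defs.v *)
From HB Require Import structures.
From mathcomp Require Import all_boot all_order all_algebra.
From mathcomp Require Import all_classical all_reals all_analysis.
From mathcomp Require Import measurable_realfun ring lra.
Set Implicit Arguments.
Unset Strict Implicit.
Unset Printing Implicit Defensive.
Import Order.TTheory GRing.Theory Num.Theory.
Import numFieldNormedType.Exports.
Local Open Scope classical_set_scope.
Local Open Scope ring_scope.

Section lebesgue_tuple.
Context {R : realType}.
Notation mR := (measurableTypeR R).

Definition cons_tuple n (p : mR * n.-tuple mR) : n.+1.-tuple mR :=
  [the n.+1.-tuple mR of p.1 :: p.2].

Lemma measurable_cons_tuple n : measurable_fun setT (@cons_tuple n).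
Proof. by apply: measurable_cons; [exact: measurable_fst|exact: measurable_snd]. Qed.

HB.instance Definition _ n :=
  isMeasurableFun.Build _ _ _ _ (@cons_tuple n) (@measurable_cons_tuple n).

Section cons_measure.
Variables (n : nat) (m : {sigma_finite_measure set (n.-tuple mR) -> \bar R}).

Definition lebesgue_cons :=
  pushforward (lebesgue_measure \x m)%E (@cons_tuple n).

Let lebesgue_cons0 : lebesgue_cons set0 = 0%E.
Proof. exact: measure0. Qed.

Let lebesgue_cons_ge0 A : (0 <= lebesgue_cons A)%E.
Proof. exact: measure_ge0. Qed.

Let lebesgue_cons_sigma_additive : semi_sigma_additive lebesgue_cons.
Proof. exact: measure_semi_sigma_additive. Qed.

HB.instance Definition _ := isMeasure.Build _ _ _ lebesgue_cons
  lebesgue_cons0 lebesgue_cons_ge0 lebesgue_cons_sigma_additive.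

Let uncons (t : n.+1.-tuple mR) : mR * n.-tuple mR :=
  (thead t, [tuple of behead t]).

Let lebesgue_cons_sigma_finite : sigma_finite setT lebesgue_cons.
Proof.
have /sigma_finiteP[F [TF ndF Foo]] := sigma_finiteT (@lebesgue_measure R).
have /sigma_finiteP[G [TG ndG Goo]] := sigma_finiteT m.
have muncons : measurable_fun setT uncons.
  apply/measurable_fun_pairP; split; first exact: measurable_tnth.
  exact: measurable_behead.
exists (fun k => uncons @^-1` (F k `*` G k)) => [|k].
  rewrite -preimage_bigcup -(preimage_setT uncons); congr (_ @^-1` _).
  apply/seteqP; split=> // -[x y] _.
  have [i _ Fx] : (\bigcup_i F i) x by rewrite -TF.
  have [j _ Gy] : (\bigcup_i G i) y by rewrite -TG.
  exists (maxn i j) => //; split=> /=.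
  - by move: x Fx; apply/subsetPset/ndF/leq_maxl.
  - by move: y Gy; apply/subsetPset/ndG/leq_maxr.
have [mF Fk] := Foo k; have [mG Gk] := Goo k; split.
  by rewrite -[X in measurable X]setTI; apply: muncons => //; exact: measurableX.
rewrite /lebesgue_cons /pushforward -comp_preimage.
rewrite (_ : _ \o _ = id); last by apply/funext => -[x t] /=; congr pair; exact/val_inj.
by rewrite preimage_id product_measure1E// lte_mul_pinfty// ge0_fin_numE.
Qed.

HB.instance Definition _ := Measure_isSigmaFinite.Build _ _ _ lebesgue_cons
  lebesgue_cons_sigma_finite.
End cons_measure.

(* n-dimensional Lebesgue measure, as an iterated product *)
Fixpoint lebesgue_tuple n : {sigma_finite_measure set (n.-tuple mR) -> \bar R} :=
  if n is n'.+1 then lebesgue_cons (lebesgue_tuple n')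
  else \d_([tuple] : 0.-tuple mR).

End lebesgue_tuple.

Section lebesgue_rV.
Context {R : realType} (n : nat).
Notation mR := (measurableTypeR R).

(* R^n with its Borel sigma-algebra *)
Definition borelRV := g_sigma_algebraType (@open 'rV[R]_n).
HB.instance Definition _ := Measurable.on borelRV.

Definition rV_of_tuple (t : n.-tuple mR) : borelRV := \row_i tnth t i.

Lemma measurable_rV_of_tuple : measurable_fun setT rV_of_tuple.
Proof.
apply: measurability => // _ [U oU <-]; rewrite setTI.
pose bq (p : {ffun 'I_n -> rat} * rat) : set 'rV[R]_n :=
  [set x | forall i, `|x 0 i - ratr (p.1 i)| < ratr p.2].
have -> : U = \bigcup_(p in [set p | bq p `<=` U]) bq p.
  apply/seteqP; split => [x Ux|x [p /= pU /pU//]].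
  have [e /= e0 xeU] : nbhs_ball x U by apply/nbhs_ballP/open_nbhs_nbhs.
  have [r /itvP re] : exists q : rat, ratr q \in `]0, e / 2[.
    by apply: rat_in_itvoo; rewrite divr_gt0.
  have r0 : 0 < ratr r :> R by rewrite re.
  have /choice[q qP] : forall i, exists q : rat, ratr q \in `]x 0 i - ratr r, x 0 i[.
    by move=> i; apply: rat_in_itvoo; rewrite ltrBlDr ltrDl.
  have xq i : `|x 0 i - ratr (q i)| < ratr r.
    have /itvP qi := qP i.
    by rewrite gtr0_norm ?subr_gt0 ?qi// ltrBlDr -ltrBlDl qi.
  exists ([ffun i => q i], r) => /=; last by move=> i; rewrite ffunE.
  move=> y yq; apply: xeU; split => // i j; rewrite ord1.
  rewrite /ball/= -(subrK (ratr (q j)) (x 0 j)) -addrA (le_lt_trans (ler_normD _ _))//.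
  rewrite [e]splitr ltrD// ?(lt_le_trans (xq j)) ?re//.
  have := yq j; rewrite /= ffunE distrC => /lt_trans; apply; by rewrite re.
rewrite preimage_bigcup bigcup_mkcond; apply: countable_bigcupT_measurable; first exact: countableP.
move=> p.
case: ifPn => // _.
rewrite (_ : _ @^-1` _ = \bigcap_i ((@tnth n mR ^~ i) @^-1`
    [set x : mR | `|x - ratr (p.1 i)| < ratr p.2])).
  apply: fin_bigcap_measurable => // i _.
  rewrite -[X in measurable X]setTI; apply: measurable_tnth => //.
  rewrite (_ : [set x | _] =
      `]ratr (p.1 i) - ratr p.2, ratr (p.1 i) + ratr p.2[%classic); last first.
    by apply/seteqP; split=> x /=; rewrite in_itv/= ltr_distl.
  exact: (measurable_itv `]_, _[).
apply/seteqP; split => t /= tp i; first by move=> _ /=; have := tp i; rewrite mxE.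
by rewrite mxE; exact: tp.
Qed.

HB.instance Definition _ :=
  isMeasurableFun.Build _ _ _ _ rV_of_tuple measurable_rV_of_tuple.

Definition lebesgue_rV := pushforward (lebesgue_tuple n) rV_of_tuple.

Let lebesgue_rV0 : lebesgue_rV set0 = 0%E.
Proof. exact: measure0. Qed.

Let lebesgue_rV_ge0 A : (0 <= lebesgue_rV A)%E.
Proof. exact: measure_ge0. Qed.

Let lebesgue_rV_sigma_additive : semi_sigma_additive lebesgue_rV.
Proof. exact: measure_semi_sigma_additive. Qed.

HB.instance Definition _ := isMeasure.Build _ _ _ lebesgue_rV
  lebesgue_rV0 lebesgue_rV_ge0 lebesgue_rV_sigma_additive.

Lemma open_measurable_rV (U : set 'rV[R]_n) :
  open U -> measurable (U : set borelRV).
Proof. exact: sub_sigma_algebra. Qed.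

Variables (Omega : set 'rV[R]_n) (oO : open Omega).
(* Lebesgue measure restricted to Omega: functions on R^n are identified when
   they agree almost everywhere on Omega *)
Definition lebesgue_on : {measure set borelRV -> \bar R} :=
  mrestr lebesgue_rV (open_measurable_rV oO).
End lebesgue_rV.

HB.mixin Record isPreHilbert (R : realType) V & NormedModule R V := {
  dotv : V -> V -> R ;
  dotvC : forall x y, dotv x y = dotv y x ;
  dotvDl : forall x y z, dotv (x + y) z = dotv x z + dotv y z ;
  dotvZl : forall a x y, dotv (a *: x) y = a * dotv x y ;
  sqr_normv : forall x, `|x| ^+ 2 = dotv x x }.

#[short(type=preHilbertType)]
HB.structure Definition PreHilbert (R : realType) :=
  {V of isPreHilbert R V & NormedModule R V}.

HB.factory Record Lmodule_isPreHilbert (R : realType) V & GRing.Lmodule R V := {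
  dot : V -> V -> R ;
  dotC : forall x y, dot x y = dot y x ;
  dotDl : forall x y z, dot (x + y) z = dot x z + dot y z ;
  dotZl : forall a x y, dot (a *: x) y = a * dot x y ;
  dot_ge0 : forall x, 0 <= dot x x ;
  dot_eq0 : forall x, dot x x = 0 -> x = 0 }.

HB.builders Context R V & Lmodule_isPreHilbert R V.

Let norm (x : V) := Num.sqrt (dot x x).

Let dotDr x y z : dot x (y + z) = dot x y + dot x z.
Proof. by rewrite dotC dotDl !(dotC x). Qed.

Let dotZr a x y : dot x (a *: y) = a * dot x y.
Proof. by rewrite dotC dotZl dotC. Qed.

Let sqr_norm x : norm x ^+ 2 = dot x x.
Proof. by rewrite sqr_sqrtr// dot_ge0. Qed.

Let cauchy_schwarz x y : dot x y <= norm x * norm y.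
Proof.
have [/dot_eq0 ->|y0] := eqVneq (dot y y) 0.
  by rewrite dotC -(scale0r x) dotZl mul0r mulr_ge0// sqrtr_ge0.
have yy0 : 0 < dot y y by rewrite lt_def y0 dot_ge0.
have := dot_ge0 (x + (- (dot x y / dot y y)) *: y).
rewrite dotDl !dotDr !dotZl !dotZr (dotC y x).
set a := dot x x; set b := dot x y; set c := dot y y => abc.
have {abc} : b ^+ 2 <= a * c.
  rewrite -(ler_pdivrMr _ _ yy0) -subr_ge0; move: abc.
  rewrite [X in 0 <= X -> _](_ : _ = a - b ^+ 2 / c)//.
  by field; exact: y0.
rewrite /a /c -(sqr_norm x) -(sqr_norm y) -exprMn -ler_sqrt ?sqr_ge0//.
rewrite !sqrtr_sqr (@ger0_norm _ (_ * _)) ?mulr_ge0 ?sqrtr_ge0//.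
exact/le_trans/ler_norm.
Qed.

Let ler_normD x y : norm (x + y) <= norm x + norm y.
Proof.
rewrite -(@ler_pXn2r _ 2) ?nnegrE ?addr_ge0 ?sqrtr_ge0//.
rewrite sqrrD !sqr_norm dotDl !dotDr (dotC y x).
by have := cauchy_schwarz x y; lra.
Qed.

Let normrZ a x : norm (a *: x) = `|a| * norm x.
Proof.
by rewrite /norm dotZl dotZr mulrA -expr2 sqrtrM ?sqr_ge0// sqrtr_sqr.
Qed.

Let normr0_eq0 x : norm x = 0 -> x = 0.
Proof. by move=> n0; apply: dot_eq0; rewrite -sqr_norm n0 expr0n. Qed.

HB.instance Definition _ :=
  Lmodule_isNormed.Build R V ler_normD normrZ normr0_eq0.
HB.instance Definition _ := isPreHilbert.Build R V dotC dotDl dotZl sqr_norm.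
HB.end.

Section L2.
Context d (T : measurableType d) (R : realType) (mu : {measure set T -> \bar R}).

Definition L2 := LspaceType2 mu.
HB.instance Definition _ := gen_eqMixin L2.
HB.instance Definition _ := gen_choiceMixin L2.

Let Lf := Lfun mu 2%:E.

Lemma L2_Lfun (x : L2) : (x : T -> R) \in Lf.
Proof.
apply/andP; split; rewrite inE; last exact: Lebesgue_finite.
exact: (@measurable_funPT _ _ _ _ (repr (x : {mfun_ mu, T >-> measurableTypeR R}))).
Qed.

Lemma L2_eqP (x y : L2) : (x : T -> R) = y %[ae mu] -> x = y.
Proof.
case: x y => [x [[xP]]] [y [[yP]]] /= xy.
have {xy} xy : x = y by have /eqP := introT (ae_eqP x y) xy; rewrite !reprK.
by rewrite xy in xP *; rewrite (Prop_irrelevance xP yP).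
Qed.

Section mk.
Variables (f : T -> R) (fP : f \in Lf).

Let mf : measurable_fun setT (f : T -> measurableTypeR R) :=
  set_mem (sub_Lfun_mfun fP).

Let F : {mfun T >-> measurableTypeR R} :=
  HB.pack f (isMeasurableFun.Build _ _ _ _ (f : T -> measurableTypeR R) mf).

Let piF : {mfun_ mu, T >-> measurableTypeR R} := (\pi F)%qT.

Let piF_ae : f = piF %[ae mu].
Proof.
have : (F = repr piF %[mod {mfun_ mu, T >-> measurableTypeR R}])%qT by rewrite reprK.
by move/eqmodP => /asboolP.
Qed.

Let piF_fin : finite_norm mu 2%:E piF.
Proof.
have mabs (h : T -> R) : measurable_fun setT h ->
    measurable_fun setT (fun x => `|EFin (h x)| `^ 2)%E.
  move=> mh; apply: (measurableT_comp (measurable_poweR 2)).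
  by apply: measurableT_comp => //; exact/measurable_EFinP.
have intE : (\int[mu]_x `|(f x)%:E| `^ 2 = \int[mu]_x `|(piF x)%:E| `^ 2)%E.
  apply: ae_eq_integral => //.
  - exact: (mabs _ mf).
  - exact: (mabs _ (@measurable_funPT _ _ _ _ (repr piF))).
  - by apply: filterS piF_ae => x /(_ I) /= ->.
have : ('N[mu]_2%:E[EFin \o f] < +oo)%E.
  exact: (set_mem (sub_Lfun_finLfun fP)).
by rewrite /finite_norm unlock /Lnorm intE.
Qed.

Definition L2_of : L2 :=
  HB.pack piF (isFinLebesgue.Build d T R mu 2%:E (lee1n 2) piF piF_fin).

Lemma L2_ofE : (L2_of : T -> R) = f %[ae mu].
Proof. exact/ae_eq_sym/piF_ae. Qed.
End mk.

Let p1 : (1 <= 2%:E :> \bar R)%E := lee1n 2.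

Let LfD (x y : L2) : (fun t => x t + y t) \in Lf.
Proof. exact: (Lfun_addr_closed mu p1).2 _ _ (L2_Lfun x) (L2_Lfun y). Qed.
Let LfN (x : L2) : (fun t => - x t) \in Lf.
Proof. exact: (Lfun_oppr_closed (L2_Lfun x)). Qed.
Let Lf0 : (fun=> 0) \in Lf.
Proof. exact: (Lfun_addr_closed mu p1).1. Qed.
Let LfZ a (x : L2) : (fun t => a * x t) \in Lf.
Proof.
have := (Lfun_submod_closed mu p1).2 a _ _ (L2_Lfun x) Lf0.
rewrite [X in X \in _ -> _](_ : _ = (fun t => a * x t))//.
by apply/funext => t; exact: addr0.
Qed.

Let add (x y : L2) := L2_of (LfD x y).
Let opp (x : L2) := L2_of (LfN x).
Let zero := L2_of Lf0.
Let scale a (x : L2) := L2_of (LfZ a x).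

Let addE x y : \forall t \ae mu, add x y t = x t + y t.
Proof. by apply: filterS (L2_ofE (LfD x y)) => t /(_ I). Qed.
Let oppE x : \forall t \ae mu, opp x t = - x t.
Proof. by apply: filterS (L2_ofE (LfN x)) => t /(_ I). Qed.
Let zeroE : \forall t \ae mu, zero t = 0.
Proof. by apply: filterS (L2_ofE Lf0) => t /(_ I). Qed.
Let scaleE a x : \forall t \ae mu, scale a x t = a * x t.
Proof. by apply: filterS (L2_ofE (LfZ a x)) => t /(_ I). Qed.

Let addA : associative add.
Proof.
move=> x y z; apply: L2_eqP.
near=> t => _.
rewrite (near (addE x (add y z)) t)// (near (addE y z) t)//.
by rewrite (near (addE (add x y) z) t)// (near (addE x y) t)// addrA.
Unshelve. all: by end_near. Qed.

Let addC : commutative add.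
Proof.
move=> x y; apply: L2_eqP; near=> t => _.
by rewrite (near (addE x y) t)// (near (addE y x) t)// addrC.
Unshelve. all: by end_near. Qed.

Let add0 : left_id zero add.
Proof.
move=> x; apply: L2_eqP; near=> t => _.
by rewrite (near (addE zero x) t)// (near zeroE t)// add0r.
Unshelve. all: by end_near. Qed.

Let addN : left_inverse zero opp add.
Proof.
move=> x; apply: L2_eqP; near=> t => _.
rewrite (near (addE (opp x) x) t)// (near (oppE x) t)// addNr.
by rewrite (near zeroE t).
Unshelve. all: by end_near. Qed.

HB.instance Definition _ := GRing.isZmodule.Build L2 addA addC add0 addN.

Let scaleA a b (x : L2) : scale a (scale b x) = scale (a * b) x.
Proof.
apply: L2_eqP; near=> t => _.
rewrite (near (scaleE a (scale b x)) t)// (near (scaleE b x) t)//.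
by rewrite (near (scaleE (a * b) x) t)// mulrA.
Unshelve. all: by end_near. Qed.

Let scale1 : left_id 1 scale.
Proof.
move=> x; apply: L2_eqP; near=> t => _.
by rewrite (near (scaleE 1 x) t)// mul1r.
Unshelve. all: by end_near. Qed.

Let scaleDr : right_distributive scale +%R.
Proof.
move=> a x y; apply: L2_eqP; near=> t => _.
rewrite (near (scaleE a (x + y)) t)// (near (addE x y) t)//.
rewrite (near (addE (scale a x) (scale a y)) t)//.
by rewrite (near (scaleE a x) t)// (near (scaleE a y) t)// mulrDr.
Unshelve. all: by end_near. Qed.

Let scaleDl x : {morph scale^~ x : a b / a + b}.
Proof.
move=> a b; apply: L2_eqP; near=> t => _.
rewrite (near (scaleE (a + b) x) t)//.
rewrite (near (addE (scale a x) (scale b x)) t)//.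
by rewrite (near (scaleE a x) t)// (near (scaleE b x) t)// mulrDl.
Unshelve. all: by end_near. Qed.

HB.instance Definition _ :=
  GRing.Zmodule_isLmodule.Build R L2 scaleA scale1 scaleDr scaleDl.

Let dot (x y : L2) : R := \int[mu]_t (x t * y t).

Let integrableM (x y : L2) :
  mu.-integrable setT (EFin \o (fun t => x t * y t)).
Proof. exact/Lfun1_integrable/(Lfun2_mul_Lfun1 (L2_Lfun x) (L2_Lfun y)). Qed.

Let measM (x y : L2) : measurable_fun setT (EFin \o (fun t => x t * y t)).
Proof. exact: measurable_int (integrableM x y). Qed.

Let dotC x y : dot x y = dot y x.
Proof. by congr fine; apply: eq_integral => t _; rewrite mulrC. Qed.

Let dotDl x y z : dot (x + y) z = dot x z + dot y z.
Proof.
rewrite -RintegralD//; congr fine; apply: ae_eq_integral => //.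
- exact: (measM (x + y) z).
- by apply/measurable_EFinP; apply: measurable_funD; exact/measurable_EFinP.
- by apply: filterS (addE x y) => t xy _ /=; rewrite xy mulrDl.
Qed.

Let dotZl a x y : dot (a *: x) y = a * dot x y.
Proof.
rewrite -RintegralZl//; congr fine; apply: ae_eq_integral => //.
- exact: (measM (a *: x) y).
- by apply/measurable_EFinP; apply: measurable_funM => //; exact/measurable_EFinP.
- by apply: filterS (scaleE a x) => t ax _ /=; rewrite ax mulrA.
Qed.

Let dot_ge0 x : 0 <= dot x x.
Proof. by apply: Rintegral_ge0 => t _; rewrite -expr2 sqr_ge0. Qed.

Let dot_eq0 x : dot x x = 0 -> x = 0.
Proof.
move=> xx0; apply: L2_eqP.
have : (\int[mu]_t `|(EFin \o (fun t => (x t * x t)%R)) t| = 0)%E.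
  under eq_integral => t _ do rewrite gee0_abs ?lee_fin -?expr2 ?sqr_ge0//.
  by rewrite -[LHS]fineK; [congr EFin|exact: integrable_fin_num].
move=> /(ae_eq_integral_abs _ measurableT (measM x x)) h.
near=> t => _; rewrite (near zeroE t)//.
have /eqP : (x t * x t)%:E = 0%E by apply: (near h t).
by rewrite eqe mulf_eq0 orbb => /eqP.
Unshelve. all: by end_near. Qed.

HB.instance Definition _ :=
  Lmodule_isPreHilbert.Build R L2 dotC dotDl dotZl dot_ge0 dot_eq0.
End L2.

Section smooth_boundary.
Context {R : realType} {n : nat}.
Implicit Types (U Omega : set 'rV[R]_n) (f : 'rV[R]_n -> R).

Fixpoint Ck (k : nat) U f : Prop :=
  if k is k'.+1 then
    forall i : 'I_n, (forall x, U x -> derivable f x (delta_mx 0 i)) /\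
      Ck k' U (fun x => 'D_(delta_mx 0 i) f x)
  else forall x, U x -> {for x, continuous f}.

Definition smooth_on U f := forall k, Ck k U f.

(* Omega lies locally on one side of a smooth hypersurface; for an open set,
   closure Omega `\` Omega is the boundary. *)
Definition smooth_boundary Omega :=
  forall p, (closure Omega `\` Omega) p ->
  exists U rho, [/\ open_nbhs p U, smooth_on U rho,
    exists i : 'I_n, 'D_(delta_mx 0 i) rho p != 0 &
    Omega `&` U = [set x | U x /\ rho x < 0]].

End smooth_boundary.

Section unbounded_operators.
Context {R : realType} {V : preHilbertType R}.

(* Only the values of op_fun on dom are meaningful. *)
Record linop := LinOp {
  dom : set V ;
  op_fun :> V -> V ;
  dom0 : dom 0 ;
  dom_linear : forall a x y, dom x -> dom y -> dom (a *: x + y) ;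
  op_linear : forall a x y, dom x -> dom y ->
    op_fun (a *: x + y) = a *: op_fun x + op_fun y }.

Implicit Types A : linop.

Definition densely_defined A := dense (dom A).

(* the graph of A coincides with the graph of its adjoint *)
Definition self_adjoint A := densely_defined A /\
  forall y z, (forall x, dom A x -> dotv (A x) y = dotv x z) <->
              (dom A y /\ A y = z).

Definition positive A := forall x, dom A x -> x != 0 -> 0 < dotv (A x) x.

Definition unbounded A :=
  ~ exists C : R, forall x, dom A x -> `|A x| <= C * `|x|.

Definition resolvent_set A : set R := [set l |
  (forall y, exists! x, dom A x /\ A x - l *: x = y) /\
  (exists C : R, forall x, dom A x -> `|x| <= C * `|A x - l *: x|)].

Definition spectrum A : set R := ~` resolvent_set A.

Definition eigenspace A l : set V := [set x | dom A x /\ A x = l *: x].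

Definition finite_dimensional (W : set V) := exists (m : nat) (b : 'I_m -> V),
  forall x, W x -> exists c : 'I_m -> R, x = \sum_(i < m) c i *: b i.

Definition discrete_spectrum A :=
  spectrum A `<=` isolated (spectrum A) /\
  forall l, spectrum A l ->
    (exists2 x, eigenspace A l x & x != 0) /\ finite_dimensional (eigenspace A l).

End unbounded_operators.
Arguments linop {R} V.

Section resolution_of_identity.
Context {R : realType} {V : preHilbertType R}.

Record resolution := Resolution {
  proj :> R -> V -> V ;
  proj_linear : forall l a x y, proj l (a *: x + y) = a *: proj l x + proj l y ;
  proj_symmetric : forall l x y, dotv (proj l x) y = dotv x (proj l y) ;
  proj_min : forall l m x, proj l (proj m x) = proj (Num.min l m) x ;
  proj_right_continuous : forall x, right_continuous (proj ^~ x) ;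
  proj_Ny : forall x, proj l x @[l --> -oo] --> (0 : V) ;
  proj_y : forall x, proj l x @[l --> +oo] --> x }.

Definition spectral_cdf (E : resolution) (x : V) : R -> R :=
  fun l => dotv (E l x) x.

Section cumulative.
Variables (E : resolution) (x : V).

Let cdfE l : spectral_cdf E x l = `|E l x| ^+ 2.
Proof.
by rewrite sqr_normv [RHS]proj_symmetric proj_min minxx; exact: dotvC.
Qed.

Let cdf_nondecreasing : nondecreasing (spectral_cdf E x).
Proof.
move=> l m lm.
have lE : dotv (E l x) (E m x) = spectral_cdf E x l.
  by rewrite -proj_symmetric proj_min minC min_l.
have : 0 <= `|E m x - E l x| ^+ 2 by rewrite sqr_ge0.
rewrite sqr_normv -scaleN1r dotvDl dotvZl !(dotvC _ (_ + _)) !dotvDl !dotvZl lE.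
by rewrite (dotvC (E m x)) lE -!sqr_normv -!cdfE; lra.
Qed.

Let cdf_right_continuous : right_continuous (spectral_cdf E x).
Proof.
move=> l; rewrite cdfE (_ : spectral_cdf E x = fun l => `|E l x| ^+ 2).
  by apply: cvgM; apply: cvg_norm; exact: proj_right_continuous.
by apply/funext => m; exact: cdfE.
Qed.

HB.instance Definition _ := isCumulative.Build R _ R (spectral_cdf E x)
  cdf_nondecreasing cdf_right_continuous.
End cumulative.

Implicit Types (E : resolution) (f : R -> R) (x y : V).

Definition spectral_measure E x := lebesgue_stieltjes_measure (spectral_cdf E x).

(* \int f(l) d<E_l x, y>, obtained from the measures d<E_l x, x> by
   polarization *)
Definition spectral_form E f x y : R :=
  (\int[spectral_measure E (x + y)]_l f l -
   \int[spectral_measure E (x - y)]_l f l) / 4.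

Definition calculus_dom E f : set V :=
  [set x | (\int[spectral_measure E x]_l (f l ^+ 2)%:E < +oo)%E].

Definition is_calculus E f x z :=
  forall y, calculus_dom E f y -> dotv z y = spectral_form E f x y.

(* f(A) x = \int f(l) dE_l x, in the weak sense; f(A) x is set to 0 outside of
   the domain *)
Definition calculus E f x : V :=
  xget 0 [set z | calculus_dom E f x /\ is_calculus E f x z].

Definition associated E (A : linop V) :=
  dom A = calculus_dom E id /\ forall x, dom A x -> is_calculus E id x (A x).

Definition Hs_sqnorm E (s : R) x : \bar R :=
  \int[spectral_measure E x]_(l in `[0, +oo[) ((1 + l ^+ 2) `^ s)%:E.

Definition Hs E s : set V := [set x | (Hs_sqnorm E s x < +oo)%E].

Definition Hs_norm E s x : R := Num.sqrt (fine (Hs_sqnorm E s x)).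

(* Continuous linear forms on H^s, encoded as functions on H vanishing outside
   of H^s so that equality of forms is equality of functions. *)
Definition Hs_form E s : {pred V -> R^o} := [pred F : V -> R^o | `[<
  [/\ forall a x y, Hs E s x -> Hs E s y -> F (a *: x + y) = a * F x + F y,
      exists C : R, forall x, Hs E s x -> `|F x| <= C * Hs_norm E s x &
      forall x, ~ Hs E s x -> F x = 0] >]].

Lemma Hs_form_submod E s : submod_closed (Hs_form E s).
Proof.
split=> [|a F G /asboolP[Flin [C FC] F0] /asboolP[Glin [D GD] G0]].
  apply/asboolP; split=> // [a x y _ _|]; first by rewrite mulr0 addr0.
  by exists 0 => x _; rewrite mul0r normr0.
have evE x : (a *: F + G) x = a * F x + G x by [].
apply/asboolP; split=> [b x y xs ys||x xs].
- by rewrite !evE Flin// Glin//; ring.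
- exists (`|a| * C + D) => x xs; rewrite evE (le_trans (ler_normD _ _))//.
  by rewrite mulrDl lerD ?GD// normrM -mulrA ler_wpM2l ?FC.
- by rewrite evE F0// G0// mulr0 addr0.
Qed.

HB.instance Definition _ E s :=
  GRing.isSubmodClosed.Build R (V -> R^o) (Hs_form E s) (Hs_form_submod E s).

Record Hneg E s := HNeg { form :> V -> R^o ; formP : form \in Hs_form E s }.
HB.instance Definition _ E s := [isSub for @form E s].
HB.instance Definition _ E s := [Choice of Hneg E s by <:].
HB.instance Definition _ E s := [SubChoice_isSubLmodule of Hneg E s by <:].

(* the operator norm of a form on H^s *)
Definition Hneg_norm E s (F : Hneg E s) : R :=
  sup [set `|F x| | x in [set x | Hs E s x /\ Hs_norm E s x <= 1]].

(* The dual norm is Hilbertian; polarization recovers its inner product. *)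
Definition Hneg_dot E s (F G : Hneg E s) : R :=
  (Hneg_norm (F + G) ^+ 2 - Hneg_norm (F - G) ^+ 2) / 4.

End resolution_of_identity.
Arguments resolution {R} V.

Section extension.
Context {R : realType} {V : preHilbertType R}.
Variables (E : resolution V) (s : R).

(* T extends B to H^{-s}: by transposition (B being symmetric on the pivot
   space H), and in agreement with B on the forms <phi, .> with phi in H. *)
Definition extension (B : V -> V) (T : Hneg E s -> Hneg E s) :=
  (forall (F : Hneg E s) x, Hs E s x -> T F x = F (B x)) /\
  (forall (F : Hneg E s) y,
    (forall x, Hs E s x -> F x = dotv y x) ->
    forall x, Hs E s x -> T F x = dotv (B y) x).

End extension.

Section bounded_operators.
Context {R : realType} {X : lmodType R}.
Variables (nrm : X -> R) (dot : X -> X -> R) (S : X -> X).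

Definition op_positive := forall x, x != 0 -> 0 < dot (S x) x.

Definition op_self_adjoint := forall x y, dot (S x) y = dot x (S y).

Definition nonexpansive := forall x, nrm (S x) <= nrm x.

Definition regular_asymptotic :=
  forall x, nrm (iter k.+1 S x - iter k S x) @[k --> \oo] --> (0 : R).

Definition point_spectrum : set R :=
  [set l | exists2 x, x != 0 & S x = l *: x].

End bounded_operators.

Definition tanh {R : realType} (x : R) : R :=
  (expR x - expR (- x)) / (expR x + expR (- x)).

(* Main.v *)
Require Import Defs.
From HB Require Import structures.
From mathcomp Require Import all_boot all_order all_algebra.
From mathcomp Require Import all_classical all_reals all_analysis.
From mathcomp Require Import measurable_realfun ring lra.
Import Order.TTheory GRing.Theory Num.Theory.
Import numFieldNormedType.Exports.
Local Open Scope classical_set_scope.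
Local Open Scope ring_scope.

Set Implicit Arguments.
Unset Strict Implicit.
Unset Printing Implicit Defensive.

(** Positivity of [A] confines its spectral measure to the open half-line
[]0, +oo[], where [0 < tanh (l * T) < 1]. Everything else is transported from
the negative space to the pivot space [V], on which the operator is simply
[B = t \o t] with [t = tanh (A T)].

The transport is the isometry [J = r(A)], [r l = (1 + l ^+ 2) `^ - (s / 2)], of
[V] onto [H^s] ([Hs_isometry]). A form [F] on [H^s] is determined by the bounded
form [F \o J] on [V], which by Riesz's theorem is the scalar product with a
vector, [Hneg_vector F]; this identifies [H^-s] with [V], together with norms
and scalar products. As [B] is symmetric and commutes with [J], precomposing a
form with [B] means applying [B] to its vector. It remains to see that

- [dotv (B f) f = `|t f| ^+ 2], which is positive for [f != 0];
- [`|B f| <= `|f|];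
- [B ^ k.+1 f - B ^ k f] tends to [0], because its square norm is the integral
  of [(b ^+ k.+1 - b ^+ k) ^+ 2] for [b l = tanh (l * T) ^+ 2 < 1];
- a fixed vector of [B] is the limit of its own iterates, hence [0]; the same
  argument for [1 - B] shows that [B] is injective.

The functional calculus behind these statements concerns bounded measurable
functions only. An operator [P] is [p(A)] when [dotv (P x) y] is the integral of
[p] against the signed measure of the pair [(x, y)] ([represents]). Such a [P]
exists by Riesz's theorem, hence by completeness of [L2]; linearity, symmetry
and multiplicativity in [p] are identities between functionals of [p] that are
linear and continuous under bounded convergence, and it suffices to verify them
on the indicators of intervals []a, b]] ([integral_unique]). *)

(** * Inner products and the Riesz representation theorem *)

Definition cauchy_seq {R : realType} {V : normedModType R} (u : nat -> V) :=
  forall e : R, 0 < e -> exists N, forall m n,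
    (N <= m)%N -> (N <= n)%N -> `|u m - u n| < e.

Definition cauchy_complete {R : realType} (V : normedModType R) :=
  forall u : nat -> V, cauchy_seq u -> exists x : V, u n @[n --> \oo] --> x.

Section prehilbert.
Context {R : realType} {V : preHilbertType R}.
Implicit Types (x y z : V) (a : R).

Lemma dotvDr x y z : dotv x (y + z) = dotv x y + dotv x z.
Proof. by rewrite dotvC dotvDl !(dotvC x). Qed.

Lemma dotvZr a x y : dotv x (a *: y) = a * dotv x y.
Proof. by rewrite dotvC dotvZl dotvC. Qed.

Lemma dotv0l x : dotv 0 x = 0.
Proof. by rewrite -(scale0r 0) dotvZl mul0r. Qed.

Lemma dotv0r x : dotv x 0 = 0.
Proof. by rewrite dotvC dotv0l. Qed.

Lemma dotvNl x y : dotv (- x) y = - dotv x y.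
Proof. by rewrite -scaleN1r dotvZl mulN1r. Qed.

Lemma dotvNr x y : dotv x (- y) = - dotv x y.
Proof. by rewrite dotvC dotvNl dotvC. Qed.

Lemma dotvBl x y z : dotv (x - y) z = dotv x z - dotv y z.
Proof. by rewrite dotvDl dotvNl. Qed.

Lemma sqr_normvD x y : `|x + y| ^+ 2 = `|x| ^+ 2 + 2 * dotv x y + `|y| ^+ 2.
Proof. rewrite !sqr_normv dotvDl !dotvDr (dotvC y x); ring. Qed.

Lemma polarization x y : (`|x + y| ^+ 2 - `|x - y| ^+ 2) / 4 = dotv x y.
Proof. by rewrite !sqr_normvD dotvNr normrN; field. Qed.

Lemma dotv_ext x y : (forall z, dotv x z = dotv y z) -> x = y.
Proof.
move=> xy; apply/eqP; rewrite -subr_eq0 -normr_eq0 -sqrf_eq0 sqr_normv.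
by rewrite dotvBl xy subrr.
Qed.

Lemma dotv_le x y : dotv x y <= `|x| * `|y|.
Proof.
have := ler_normD x y; rewrite -(@ler_pXn2r _ 2) ?nnegrE ?addr_ge0//.
by rewrite sqr_normvD sqrrD; lra.
Qed.

Lemma cauchy_schwarz x y : `|dotv x y| <= `|x| * `|y|.
Proof.
rewrite ler_norml dotv_le andbT lerNl -dotvNl -(normrN x).
exact: dotv_le.
Qed.

Lemma cvg_dotvl (u : nat -> V) x y : u n @[n --> \oo] --> x ->
  dotv (u n) y @[n --> \oo] --> dotv x y.
Proof.
move=> ux; apply/cvgrPdist_le => e e0.
have d0 : 0 < e / (`|y| + 1) by rewrite divr_gt0// ltr_wpDl.
move/cvgrPdist_le : ux => /(_ _ d0); apply: filterS => n un.
rewrite -dotvBl (le_trans (cauchy_schwarz _ _))//.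
rewrite (@le_trans _ _ (e / (`|y| + 1) * (`|y| + 1)))//.
  by rewrite ler_pM// lerDl.
by rewrite divfK// gt_eqF// ltr_wpDl.
Qed.

(** The minimiser of [|x|^2 - 2 F x] represents [F]: by the parallelogram
identity minimising sequences are Cauchy, and the variation of the functional
along each line through the limit must vanish. *)
Theorem riesz_representation (F : V -> R) (C : R) : cauchy_complete V ->
  (forall a x y, F (a *: x + y) = a * F x + F y) ->
  (forall x, `|F x| <= C * `|x|) ->
  exists f, forall x, F x = dotv f x.
Proof.
move=> cV Flin Fbnd.
have F0 : F 0 = 0.
  by have := Flin (-1) 0 0; rewrite scaler0 addr0 mulN1r addNr.
have FZ a x : F (a *: x) = a * F x by rewrite -[_ *: x]addr0 Flin F0 addr0.
have FD x y : F (x + y) = F x + F y by rewrite -[x]scale1r Flin scale1r mul1r.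
pose J x := `|x| ^+ 2 - 2 * F x.
have Jlb x : - (C ^+ 2) <= J x.
  have := Fbnd x; rewrite ler_norml /J => /andP[_ Fx].
  by have := sqr_ge0 (`|x| - C); rewrite sqrrB; lra.
have hasJ : has_inf (range J).
  split; first by exists (J 0), 0.
  by exists (- (C ^+ 2)) => _ [x _ <-].
set m := inf (range J).
have Jm x : m <= J x by apply: ge_inf; [exact: hasJ.2|exists x].
have /choice[u uP] : forall n : nat, exists x, J x < m + n.+1%:R^-1.
  move=> n; have n0 : 0 < n.+1%:R^-1 :> R by rewrite invr_gt0.
  by have [_ [x _ <-] xm] := inf_adherent n0 hasJ; exists x.
have uC : cauchy_seq u.
  move=> e e0; have e20 : 0 < e ^+ 2 / 4 by rewrite divr_gt0// exprn_gt0.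
  have [N _ NP] := near_infty_natSinv_lt (PosNum e20).
  exists N => i j Ni Nj.
  have D k : (N <= k)%N -> J (u k) < m + e ^+ 2 / 4.
    by move=> Nk; rewrite (lt_trans (uP k))// ltrD2l; exact: NP.
  have Di := D i Ni; have Dj := D j Nj.
  rewrite -(@ltr_pXn2r _ 2) ?nnegrE ?(ltW e0)//.
  have := Jm (2^-1 *: (u i + u j)).
  move: Di Dj; rewrite /J FZ FD normrZ exprMn sqr_normvD.
  rewrite (@sqr_normvD (u i) (- u j)) normrN dotvNr ger0_norm ?invr_ge0//.
  lra.
have [f uf] := cV _ uC.
exists f => y.
have main t : 0 <= t ^+ 2 * `|y| ^+ 2 + 2 * t * (dotv f y - F y).
  have lim1 : t ^+ 2 * `|y| ^+ 2 + 2 * t * (dotv (u n) y - F y) @[n --> \oo]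
      --> t ^+ 2 * `|y| ^+ 2 + 2 * t * (dotv f y - F y).
    apply: cvgD; first exact: cvg_cst.
    apply: cvgM; first exact: cvg_cst.
    by apply: cvgB; [exact: cvg_dotvl|exact: cvg_cst].
  have lim2 : - (n.+1%:R^-1 : R) @[n --> \oo] --> (- 0 : R).
    by apply: cvgN; exact: cvg_harmonic.
  rewrite -oppr0; apply: (ler_cvg_to lim2 lim1); apply: nearW => n.
  have := Jm (u n + t *: y); have := uP n.
  rewrite /J FD FZ sqr_normvD dotvZr normrZ exprMn (real_normK (num_real t)).
  rewrite mulrBr !mulrA mulrDr mulrA; move: (n.+1%:R^-1 : R) => i; lra.
have [/eqP yy0|yy0] := eqVneq (`|y| ^+ 2) 0.
  move: yy0; rewrite sqrf_eq0 normr_eq0 => /eqP ->.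
  by rewrite F0 dotv0r.
have yy1 : 0 < `|y| ^+ 2 by rewrite lt_def yy0 sqr_ge0.
have := main (- (dotv f y - F y) / `|y| ^+ 2).
set d := dotv f y - F y; set q := `|y| ^+ 2 in yy0 yy1 *.
have -> : (- d / q) ^+ 2 * q + 2 * (- d / q) * d = - (d ^+ 2 / q).
  by field.
rewrite oppr_ge0 pmulr_lle0 ?invr_gt0// => d2.
have /eqP : d ^+ 2 = 0 by apply/eqP; rewrite eq_le d2 sqr_ge0.
by rewrite sqrf_eq0 subr_eq0 => /eqP.
Qed.

End prehilbert.

(** * Completeness of [L2] *)

Section L2_complete.
Context d (T : measurableType d) (R : realType) (mu : {measure set T -> \bar R}).
Implicit Types x y : L2 mu.

Lemma L2_measurable x : measurable_fun setT (x : T -> R).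
Proof. exact: set_mem (sub_Lfun_mfun (L2_Lfun x)). Qed.

Lemma L2_subE x y : ((x - y)%R : T -> R) = (fun t => x t - y t) %[ae mu].
Proof.
have h1 : ((x - y)%R : T -> R) = (fun t => x t + (- y)%R t) %[ae mu].
  exact: L2_ofE.
have h2 : ((- y)%R : T -> R) = (fun t => - y t) %[ae mu] by exact: L2_ofE.
by apply: filterS2 h1 h2 => t e1 e2 _; rewrite e1// e2.
Qed.

Lemma L2_sqr_norm x : ((`|x| ^+ 2)%:E = \int[mu]_t ((x t) ^+ 2)%:E)%E.
Proof.
have ix := Lfun2_integrable_sqr (L2_Lfun x).
rewrite sqr_normv -[dotv x x]/(\int[mu]_t (x t * x t)) /Rintegral fineK//.
exact: integrable_fin_num.
Qed.

Let msqr (f : T -> R) : measurable_fun setT f ->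
  measurable_fun setT (fun t => (f t ^+ 2)%:E).
Proof. by move=> mf; apply/measurable_EFinP; exact: measurable_funX. Qed.

Lemma L2_sqr_ae x (f : T -> R) : measurable_fun setT f ->
  (x : T -> R) = f %[ae mu] -> ((`|x| ^+ 2)%:E = \int[mu]_t ((f t) ^+ 2)%:E)%E.
Proof.
move=> mf xf; rewrite L2_sqr_norm; apply: ae_eq_integral => //.
- exact/msqr/L2_measurable.
- exact: msqr.
- by apply: filterS xf => t /= -> .
Qed.

Lemma Lfun2_sqr (f : T -> R) : measurable_fun setT f ->
  (\int[mu]_t (f t ^+ 2)%:E < +oo)%E -> f \in Lfun mu 2%:E.
Proof.
move=> mf f2; apply/andP; split; rewrite inE//=.
rewrite /finite_norm unlock /Lnorm poweR_lty//.
rewrite (eq_integral (fun t => (f t ^+ 2)%:E))// => t _.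
by rewrite /= powR_mulrn// real_normK// num_real.
Qed.

(** For a subsequence [w] with [`|w_k.+1 - w_k| <= 4 ^ - k], the weighted sum of
the [(w_k.+1 - w_k) ^+ 2 / 4 ^ - k] has a finite integral. It is thus finite
almost everywhere, where the increments of [w] are [O(2 ^ - k)] and [w] converges.
Fatou's lemma turns the Cauchy property into convergence in norm. *)
Theorem L2_complete : cauchy_complete (L2 mu).
Proof.
move=> u uC; pose q : R := 4^-1; pose h : R := 2^-1.
have q0 k : 0 < q ^+ k by rewrite exprn_gt0// invr_gt0.
have qh k : q ^+ k = (h ^+ k) ^+ 2.
  by rewrite -exprM mulnC exprM; congr (_ ^+ _); rewrite /q /h; lra.
have /choice[N NP] k : exists N, forall m n, (N <= m)%N -> (N <= n)%N ->
  `|u m - u n| < q ^+ k by exact: uC.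
(* the partial sums dominate each [N k] and are monotone *)
pose phi k := (\sum_(i < k.+1) N i)%N.
have phiN k : (N k <= phi k)%N by rewrite /phi big_ord_recr/= leq_addl.
have phi_le i j : (i <= j)%N -> (phi i <= phi j)%N.
  elim: j => [|j IH]; first by rewrite leqn0 => /eqP ->.
  rewrite leq_eqVlt => /predU1P[->//|]; rewrite ltnS => /IH ij.
  by rewrite (leq_trans ij)// /phi [leqRHS]big_ord_recr/= leq_addr.
pose w k := u (phi k).
have wC i j : (i <= j)%N -> `|w j - w i| <= q ^+ i.
  move=> ij; apply/ltW/NP; last exact: phiN.
  exact: leq_trans (phiN i) (phi_le _ _ ij).
have mw k := L2_measurable (w k).
have mB i j : measurable_fun setT (fun t => w i t - w j t).
  exact: measurable_funB.
have wdist i j :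
  ((`|w i - w j| ^+ 2)%:E = \int[mu]_t ((w i t - w j t) ^+ 2)%:E)%E.
  by apply: L2_sqr_ae => //; exact: L2_subE.
pose D k t : \bar R := ((w k.+1 t - w k t) ^+ 2 / q ^+ k)%:E.
have mD k : measurable_fun setT (D k).
  apply/measurable_EFinP; apply: measurable_funM => //.
  exact: measurable_funX.
have D0 k t : (0 <= D k t)%E by rewrite lee_fin divr_ge0 ?sqr_ge0 ?ltW.
have iD k : (\int[mu]_t D k t <= (q ^+ k)%:E)%E.
  rewrite /D; under eq_integral do rewrite mulrC EFinM.
  rewrite ge0_integralZl//; last 3 first.
  - exact: msqr.
  - by move=> t _; rewrite lee_fin sqr_ge0.
  - by rewrite lee_fin invr_ge0 ltW.
  rewrite -wdist -EFinM lee_fin mulrC ler_pdivrMr// -expr2.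
  by rewrite ler_pXn2r ?nnegrE ?(ltW (q0 k))//; exact: wC.
have D_fin : {ae mu, forall t, (\sum_(k <oo) D k t)%E \is a fin_num}.
  have : mu.-integrable setT (fun t => \sum_(k <oo) D k t)%E.
    apply/integrableP; split.
      by apply: ge0_emeasurable_sum.
    under eq_integral do rewrite gee0_abs ?nneseries_ge0//.
    rewrite integral_nneseries//.
    apply: (@le_lt_trans _ _ 2%:E); last exact: ltry.
    apply: lime_le; first by apply: is_cvg_nneseries => *; exact: integral_ge0.
    apply: nearW => n; apply: (@le_trans _ _ (\sum_(0 <= k < n) (q ^+ k)%:E)%E).
      by apply: lee_sum => k _; exact: iD.
    rewrite sumEFin lee_fin.
    have -> : \sum_(0 <= k < n) q ^+ k = (1 - q ^+ n) * (4 / 3).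
      elim: n => [|n IH]; first by rewrite big_geq// expr0; lra.
      by rewrite big_nat_recr//= IH exprS /q; lra.
    by have := q0 n; lra.
  by move/integrable_ae => /(_ measurableT); apply: filterS => t; apply.
have w_cvg : {ae mu, forall t, cvgn (fun k => w k t)}.
  apply: filterS D_fin => t Dt.
  set C := fine (\sum_(k <oo) D k t)%E.
  have DC k : (w k.+1 t - w k t) ^+ 2 <= C * q ^+ k.
    rewrite -ler_pdivrMr// -lee_fin fineK//.
    apply: le_trans (@nneseries_lim_ge _ _ xpredT 0 k.+1 _); last by [].
    by rewrite big_nat_recr//= leeDr// sume_ge0.
  have C0 : 0 <= C by apply/fine_ge0/nneseries_ge0.
  have dC k : `|w k.+1 t - w k t| <= (C + 1) * h ^+ k.
    rewrite -(@ler_pXn2r _ 2) ?nnegrE ?mulr_ge0 ?addr_ge0 ?exprn_ge0 ?invr_ge0//.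
    rewrite real_normK ?num_real// (le_trans (DC k))// exprMn -qh.
    by rewrite ler_pM2r// expr2; nra.
  have sd : cvgn (series (telescope (fun k => w k t))).
    apply: normed_cvg.
    apply: (@series_le_cvg _ _ (fun n => (C + 1) * h ^+ n)) => //.
    - by move=> n; exact: normr_ge0.
    - by move=> n; rewrite mulr_ge0 ?addr_ge0 ?exprn_ge0 ?invr_ge0.
    - by apply: is_cvg_geometric_series; rewrite ger0_norm// /h; lra.
  rewrite (_ : (fun k => w k t) =
      (fun k => w 0%N t + series (telescope (fun k => w k t)) k)).
    by apply: is_cvgD => //; exact: is_cvg_cst.
  by apply/funext => n; exact: eq_sum_telescope.
(* the upper limit makes [g] measurable, off the null set of divergence too *)
pose g t : R := fine (limn_esup (fun k => (w k t)%:E)).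
have mg : measurable_fun setT g.
  apply: measurableT_comp; first exact: fine_measurable.
  by apply: measurable_fun_limn_esup => k; apply/measurable_EFinP.
have wg : {ae mu, forall t, w k t @[k --> \oo] --> g t}.
  apply: filterS w_cvg => t /cvg_ex[l wl].
  have wlE : (w k t)%:E @[k --> \oo] --> l%:E.
    by apply: cvg_EFin => //; exact: nearW.
  rewrite /g is_cvg_limn_esupE; last by apply/cvg_ex; exists l%:E.
  by rewrite (cvg_lim _ wlE).
have mgw k : measurable_fun setT (fun t => g t - w k t).
  exact: measurable_funB.
have fat k : (\int[mu]_t ((g t - w k t) ^+ 2)%:E <= ((q ^+ k) ^+ 2)%:E)%E.
  (* shifted by [k], so that [wC] bounds every term *)
  pose F j t : \bar R := ((w (j + k)%N t - w k t) ^+ 2)%:E.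
  have mF j : measurable_fun setT (F j) by exact/msqr.
  have -> : (\int[mu]_t ((g t - w k t) ^+ 2)%:E =
      \int[mu]_t limn_einf (F ^~ t))%E.
    apply: ae_eq_integral => //.
    - exact: msqr.
    - rewrite (_ : (fun t => _) = fun t => (- limn_esup (-%E \o F ^~ t))%E).
        apply: measurableT_comp => //; apply: measurable_fun_limn_esup => j.
        exact: measurableT_comp.
      by apply/funext => t; rewrite limn_esupN oppeK.
    apply: filterS wg => t wgt _.
    have Fg : F j t @[j --> \oo] --> ((g t - w k t) ^+ 2)%:E.
      apply: cvg_EFin; first exact: nearW.
      have wgt' : w (j + k)%N t @[j --> \oo] --> g t.
        by rewrite (cvg_shiftn k (fun j => w j t)).
      have h1 : w (j + k)%N t - w k t @[j --> \oo] --> g t - w k t.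
        by apply: cvgB => //; exact: cvg_cst.
      by apply: cvgM; exact: h1.
    by rewrite is_cvg_limn_einfE ?(cvg_lim _ Fg)//;
      apply/cvg_ex; eexists; exact: Fg.
  apply: (le_trans (fatou _ _ _ _)) => //.
    by move=> j t _; rewrite lee_fin sqr_ge0.
  rewrite limn_einf_lim; apply: lime_le; first exact: is_cvg_einfs.
  apply: nearW => j; apply: (@le_trans _ _ (\int[mu]_t F j t)%E).
    by apply: ereal_inf_lbound; exists j => /=.
  rewrite /F -wdist lee_fin ler_pXn2r ?nnegrE ?(ltW (q0 k))//.
  by apply: wC; exact: leq_addl.
have gL : g \in Lfun mu 2%:E.
  have gw : (fun t => g t - w 0%N t) \in Lfun mu 2%:E.
    by apply: Lfun2_sqr => //; exact: le_lt_trans (fat 0%N) (ltry _).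
  have := (Lfun_addr_closed mu (lee1n 2)).2 _ _ gw (L2_Lfun (w 0%N)).
  rewrite (_ : _ + _ = g)//.
  by apply/funext => t; rewrite -[LHS]/(g t - w 0%N t + w 0%N t) subrK.
pose v : L2 mu := L2_of gL.
have vw k : `|v - w k| <= q ^+ k.
  rewrite -(@ler_pXn2r _ 2) ?nnegrE ?(ltW (q0 k))// -lee_fin.
  rewrite (@L2_sqr_ae _ (fun t => g t - w k t))//.
  apply: filterS2 (L2_subE v (w k)) (L2_ofE gL) => t e1 e2 _.
  by rewrite e1// e2.
exists v; apply/cvgrPdist_lt => e e0.
have [k qk] : exists k, q ^+ k < e / 2.
  have : q ^+ k @[k --> \oo] --> (0 : R).
    by apply: cvg_expr; rewrite ger0_norm// /q; lra.
  have e20 : 0 < e / 2 by rewrite divr_gt0.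
  move/cvgrPdist_lt => /(_ _ e20)[k _ kP]; exists k.
  by have := kP k (leqnn k); rewrite /= sub0r normrN ger0_norm// ltW.
exists (phi k) => // n /= kn.
rewrite -(subrK (w k) v) -addrA (le_lt_trans (ler_normD _ _))//.
have := vw k; have : `|w k - u n| < q ^+ k.
  by apply: NP; rewrite ?(leq_trans _ kn).
by move: qk; lra.
Qed.

End L2_complete.

(** * Functionals continuous under bounded convergence *)

Section bounded_measurable.
Import HBNNSimple.
Context {d} {T : measurableType d} {R : realType}.
Implicit Types (f g : T -> R) (L : (T -> R) -> R).

Definition bmeas f := measurable_fun setT f /\ exists C, forall t, `|f t| <= C.

Lemma bmeas_lin a f g : bmeas f -> bmeas g -> bmeas (fun t => a * f t + g t).
Proof.
move=> [mf [C fC]] [mg [D gD]]; split.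
  by apply: measurable_funD => //; exact: measurable_funM.
exists (`|a| * C + D) => t; rewrite (le_trans (ler_normD _ _))// normrM.
by rewrite lerD// ler_wpM2l.
Qed.

Lemma bmeasM f g : bmeas f -> bmeas g -> bmeas (fun t => f t * g t).
Proof.
move=> [mf [C fC]] [mg [D gD]]; split; first exact: measurable_funM.
by exists (C * D) => t; rewrite normrM ler_pM.
Qed.

Lemma bmeas_cst c : bmeas (cst c).
Proof. by split => //; exists `|c|. Qed.

Lemma bmeasX f n : bmeas f -> bmeas (fun t => f t ^+ n).
Proof.
move=> bf; elim: n => [|n IH].
  under eq_fun do rewrite expr0; exact: bmeas_cst.
by under eq_fun do rewrite exprS; exact: bmeasM.
Qed.

Lemma bmeas_indic (S : set T) : measurable S -> bmeas \1_S.
Proof.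
move=> mS; split; first exact: measurable_indic.
by exists 1 => t; rewrite indicE normr_nat; case: (_ \in _).
Qed.

(** What integration of bounded functions against a finite signed measure
looks like from outside; working with such functionals makes it unnecessary to
set up signed measures. *)
Record bounded_integral L : Prop := BoundedIntegral {
  bint_lin : forall a f g, bmeas f -> bmeas g ->
    L (fun t => a * f t + g t) = a * L f + L g ;
  bint_lim : forall (f_ : nat -> T -> R) f C,
    (forall n, measurable_fun setT (f_ n)) -> (forall n t, `|f_ n t| <= C) ->
    (forall t, f_ n t @[n --> \oo] --> f t) -> L (f_ n) @[n --> \oo] --> L f }.

Lemma bounded_integral_lin a L1 L2 : bounded_integral L1 ->
  bounded_integral L2 -> bounded_integral (fun f => a * L1 f + L2 f).
Proof.
move=> [lin1 lim1] [lin2 lim2]; split=> [b f g bf bg|f_ f C mf fC ff].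
  by rewrite lin1// lin2//; ring.
apply: cvgD; last exact: lim2 ff.
by apply: cvgM; [exact: cvg_cst|exact: lim1 ff].
Qed.

Lemma bounded_integralM L q : bounded_integral L -> bmeas q ->
  bounded_integral (fun f => L (fun t => f t * q t)).
Proof.
move=> [lin lim] bq; have [mq [D qD]] := bq.
split=> [b f g bf bg|f_ f C mf fC ff].
  rewrite -lin; [|exact: bmeasM..].
  by congr L; apply/funext => t; rewrite mulrDl mulrA.
apply: (lim _ _ (C * D)) => [n|n t|t].
- exact: measurable_funM.
- by rewrite normrM ler_pM.
- by apply: cvgM; [exact: ff|exact: cvg_cst].
Qed.

Section agreement.
Variables (G : set (set T)) (L1 L2 : (T -> R) -> R).
Hypotheses (mG : @measurable _ T = <<s G >>) (IG : setI_closed G).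
Hypotheses (bL1 : bounded_integral L1) (bL2 : bounded_integral L2).
Hypotheses (L1T : L1 (cst 1) = L2 (cst 1)).
Hypotheses (LG : forall S, G S -> L1 \1_S = L2 \1_S).

Let lim_eq (f_ : nat -> T -> R) f C :
  (forall n, measurable_fun setT (f_ n)) -> (forall n t, `|f_ n t| <= C) ->
  (forall t, f_ n t @[n --> \oo] --> f t) ->
  (forall n, L1 (f_ n) = L2 (f_ n)) -> L1 f = L2 f.
Proof.
move=> mf fC ff L12; have := bint_lim bL1 mf fC ff.
under eq_fun do rewrite L12; move/cvg_lim => <- //.
by apply: cvg_lim => //; exact: bint_lim bL2 _ _ _ mf fC ff.
Qed.

Let agree_indic S : measurable S -> L1 \1_S = L2 \1_S.
Proof.
rewrite mG; move: S.
apply: (@dynkin_induction _ T G (fun S => L1 \1_S = L2 \1_S)) => //.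
- by rewrite indicT.
- move=> {}S mS LS.
  have -> : \1_(~` S) = (fun t => -1 * \1_S t + cst 1 t) :> (T -> R).
    apply/funext => t; rewrite indicC indicE mulN1r.
    by case: (t \in S) => /=; lra.
  by rewrite !bint_lin ?LS ?L1T//; (exact: bmeas_indic || exact: bmeas_cst).
- move=> F mF tF LF.
  pose U n := \bigcup_(k < n) F k.
  have mU n : measurable (U n) by apply: bigcup_measurable => k _.
  apply: (@lim_eq (fun n => \1_(U n)) _ 1) => [n|n t|t|n].
  + exact: measurable_indic.
  + by rewrite indicE normr_nat; case: (_ \in _).
  + have [[k _ Fk]|nF] := pselect ((\bigcup_k F k) t).
      rewrite indicE mem_set; last by exists k.
      apply: cvg_near_cst; exists k.+1 => // n /= kn.
      by rewrite indicE mem_set//; exists k.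
    rewrite indicE memNset//; apply: cvg_near_cst; apply: nearW => n.
    by rewrite indicE memNset//; apply: contra_not nF => -[k _ Fk]; exists k.
  + elim: n => [|n IH].
      have -> : U 0%N = set0 by rewrite /U bigcup_mkord big_ord0.
      have -> : \1_(@set0 T) = (fun t => -1 * cst 1 t + cst 1 t) :> (T -> R).
        by apply/funext => t; rewrite indic0 mulN1r addNr.
      by rewrite !bint_lin ?L1T//; exact: bmeas_cst.
    have -> : \1_(U n.+1) = (fun t => 1 * \1_(U n) t + \1_(F n) t) :> (T -> R).
      apply/funext => t; rewrite mul1r !indicE.
      rewrite /U !bigcup_mkord big_ord_recr/= -bigcup_mkord in_setU.
      have [Ft|] := boolP (t \in F n); last by rewrite orbF addr0.
      rewrite orbT memNset ?add0r// => -[k /= kn Fk].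
      have : F k `&` F n !=set0 by exists t; split => //; exact: set_mem.
      by move/(tF _ _ I I) => kE; rewrite kE ltnn in kn.
    by rewrite !bint_lin ?IH ?LF//; exact: bmeas_indic.
Qed.

Let agree_sum n (c : 'I_n -> R) (S : 'I_n -> set T) :
  (forall i, measurable (S i)) ->
  bmeas (fun t => \sum_(i < n) c i * \1_(S i) t) /\
  L1 (fun t => \sum_(i < n) c i * \1_(S i) t) =
  L2 (fun t => \sum_(i < n) c i * \1_(S i) t).
Proof.
elim: n c S => [|n IH] c S mS.
  have -> : (fun t => \sum_(i < 0) c i * \1_(S i) t) =
      (fun t => -1 * cst 1 t + cst 1 t) :> (T -> R).
    by apply/funext => t; rewrite big_ord0 mulN1r addNr.
  split; first by apply: bmeas_lin; exact: bmeas_cst.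
  by rewrite !bint_lin ?L1T//; exact: bmeas_cst.
have -> : (fun t => \sum_(i < n.+1) c i * \1_(S i) t) =
   (fun t => c ord0 * \1_(S ord0) t +
      \sum_(i < n) c (lift ord0 i) * \1_(S (lift ord0 i)) t).
  by apply/funext => t; rewrite big_ord_recl.
have [b e] := IH (c \o lift ord0) (S \o lift ord0) (fun i => mS _).
by split; [apply: bmeas_lin => //|rewrite !bint_lin// ?e ?agree_indic//];
  exact: bmeas_indic.
Qed.

(** Dynkin's lemma settles indicators, simple functions follow by linearity and
the others by bounded approximation from below. *)
Theorem bounded_integral_unique f : bmeas f -> L1 f = L2 f.
Proof.
suff nonneg g : bmeas g -> (forall t, 0 <= g t) -> L1 g = L2 g.
  move=> bf; have [mf [C fC]] := bf.
  have -> : f = (fun t => - C * cst 1 t + (1 * f t + cst C t)).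
    by apply/funext => t /=; ring.
  have bC : bmeas (fun t => 1 * f t + cst C t).
    by apply: bmeas_lin => //; exact: bmeas_cst.
  rewrite !(@bint_lin _ _ (- C))//; try exact: bmeas_cst.
  rewrite L1T nonneg// => t /=; have := fC t; rewrite ler_norml mul1r; lra.
move=> [mg [C gC]] g0.
have mEg : measurable_fun setT (EFin \o g) by exact/measurable_EFinP.
have Eg0 t : [set: T] t -> (0 <= (EFin \o g) t)%E by rewrite lee_fin.
pose h := nnsfun_approx measurableT mEg.
have hg t : h n t @[n --> \oo] --> g t.
  by have /fine_cvg := cvg_nnsfun_approx measurableT mEg Eg0 (I : setT t).
have hle n t : h n t <= g t.
  rewrite -(cvg_lim _ (hg t))//; apply: nondecreasing_cvgn_le.
    move=> i j ij.
    by have /lefP := @nd_nnsfun_approx _ _ _ _ measurableT _ mEg _ _ ij.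
  by apply/cvg_ex; exists (g t); exact: hg.
apply: (@lim_eq h _ C) => //.
- move=> n t; rewrite ger0_norm ?(le_trans (hle n t))//.
  exact/(le_trans (ler_norm _) (gC t)).
- move=> n; rewrite (funext (fimfunEord (h n))).
  by apply: (agree_sum _ _).2.
Qed.

End agreement.
End bounded_measurable.

(** * The measures of a resolution of the identity *)

Section calculus.
Context {R : realType} {V : preHilbertType R} (E : resolution V).
Notation mR := (measurableTypeR R).
Implicit Types (x y z : V) (a b l m : R) (p q : mR -> R).

Lemma projD l x y : E l (x + y) = E l x + E l y.
Proof. by rewrite -[x in LHS]scale1r proj_linear scale1r. Qed.

Lemma proj0 l : E l 0 = 0.
Proof.
by have := proj_linear E l (-1) 0 0; rewrite scaler0 addr0 scaleN1r addNr.
Qed.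

Lemma projZ l a x : E l (a *: x) = a *: E l x.
Proof. by have := proj_linear E l a x 0; rewrite proj0 !addr0. Qed.

Lemma projN l x : E l (- x) = - E l x.
Proof. by rewrite -scaleN1r projZ scaleN1r. Qed.

Lemma spectral_cdfE x l : spectral_cdf E x l = `|E l x| ^+ 2.
Proof. by rewrite sqr_normv proj_symmetric proj_min minxx dotvC. Qed.

Lemma spectral_measure_oc x a b : a <= b ->
  spectral_measure E x `]a, b] = (spectral_cdf E x b - spectral_cdf E x a)%:E.
Proof.
move=> ab; rewrite /spectral_measure /lebesgue_stieltjes_measure.
rewrite /measure_extension/= measurable_mu_extE/= ?wlength_itv_bnd//.
exact: is_ocitv.
Qed.

Lemma cvg_spectral_cdf x :
  spectral_cdf E x n%:R - spectral_cdf E x (- n%:R) @[n --> \oo] --> `|x| ^+ 2.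
Proof.
rewrite -[X in _ --> X]subr0 (_ : 0 = `|0 : V| ^+ 2); last first.
  by rewrite normr0 expr0n.
under eq_fun do rewrite !spectral_cdfE.
apply: cvgB; apply: cvgM; apply: cvg_norm.
- 1,2: exact: (@cvg_comp _ _ _ _ (E ^~ x) _ _ _ (@cvgr_idn R)
    (@proj_y _ _ E x)).
- 1,2: have nn : - (n%:R : R) @[n --> \oo] --> -oo.
  1,3: by apply/cvgNrNy; exact: cvgr_idn.
  1,2: exact: (@cvg_comp _ _ _ _ (E ^~ x) _ _ _ nn (@proj_Ny _ _ E x)).
Qed.

Let cvg_indic_oc (t : R) :
  \1_`]- n%:R, n%:R]%classic t @[n --> \oo] --> (1 : R).
Proof.
apply: cvg_near_cst; near=> n; rewrite indicE mem_set//= in_itv/=.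
have nt : `|t| < n%:R by near: n; exact: nbhs_infty_gtr.
by move: nt; rewrite ltr_norml => /andP[-> /ltW ->].
Unshelve. all: by end_near. Qed.

Lemma spectral_measureT x : spectral_measure E x setT = (`|x| ^+ 2)%:E.
Proof.
have h : spectral_measure E x `]- n%:R, n%:R]%classic @[n --> \oo] -->
    spectral_measure E x setT.
  rewrite -(bigcup_itvT false false).
  apply: nondecreasing_cvg_mu => //; first exact: bigcup_measurable.
  by move=> *; apply/subsetPset/subset_itv; rewrite leBSide/= ?lerN2 ler_nat.
suff h2 : spectral_measure E x `]- n%:R, n%:R]%classic @[n --> \oo] -->
    (`|x| ^+ 2)%:E.
  exact: cvg_unique h h2.
under eq_fun => n do rewrite spectral_measure_oc ?ge0_cp//.
by apply: cvg_EFin; [exact: nearW|exact: cvg_spectral_cdf].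
Qed.

Lemma bounded_integrable x p : bmeas p ->
  (spectral_measure E x).-integrable setT (EFin \o p).
Proof.
move=> [mp [C pC]]; apply: measurable_bounded_integrable => //.
  by have := ltry (`|x| ^+ 2); rewrite -spectral_measureT.
exists C; split; first exact: num_real.
by move=> M CM t _; exact: le_trans (pC t) (ltW CM).
Qed.

Lemma bounded_integral_measure x :
  bounded_integral (fun p => \int[spectral_measure E x]_l p l).
Proof.
split=> [a p q bp bq|f_ f C mf fC ff].
  rewrite RintegralD ?RintegralZl//; try exact: bounded_integrable.
  have := bmeas_lin a bp (bmeas_cst 0).
  by move/(bounded_integrable x); under eq_fun do rewrite addr0.
have mf' : measurable_fun setT f.
  by apply: measurable_fun_cvg => // t _; exact: ff.
have iC : (spectral_measure E x).-integrable setT (EFin \o cst C).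
  exact/bounded_integrable/bmeas_cst.
have [] := @dominated_convergence _ _ _ (spectral_measure E x) setT measurableT
  (fun n => EFin \o f_ n) (EFin \o f) (EFin \o cst C).
- by move=> n; exact/measurable_EFinP.
- exact/measurable_EFinP.
- by apply: aeW => t _; apply: cvg_EFin; [exact: nearW|exact: ff].
- exact: iC.
- by apply: aeW => t n _; rewrite lee_fin.
move=> ifi _ cv; apply: fine_cvg.
rewrite fineK; first exact: cv.
exact: integrable_fin_num.
Qed.

Lemma bounded_integral_form x y :
  bounded_integral (fun p => spectral_form E p x y).
Proof.
have h := bounded_integral_lin (-1) (bounded_integral_measure (x - y))
  (bounded_integral_measure (x + y)).
have z : bounded_integral (fun _ : mR -> R => 0).
  by split=> [a f g _ _|*]; [rewrite mulr0 addr0|exact: cvg_cst].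
have := bounded_integral_lin 4^-1 h z; congr bounded_integral.
by apply/funext => p; rewrite /spectral_form addr0 mulN1r mulrC addrC.
Qed.

Lemma spectral_measure_indic x a b : a <= b ->
  \int[spectral_measure E x]_l \1_`]a, b]%classic l =
  spectral_cdf E x b - spectral_cdf E x a.
Proof.
move=> ab; rewrite /Rintegral integral_indic// setIT.
by rewrite -[RHS]/(fine _%:E) -(spectral_measure_oc x ab).
Qed.

Lemma spectral_form_indic x y a b : a <= b ->
  spectral_form E \1_`]a, b]%classic x y = dotv (E b x) y - dotv (E a x) y.
Proof.
move=> ab; rewrite /spectral_form !spectral_measure_indic// !spectral_cdfE.
have pol l : `|E l (x + y)| ^+ 2 - `|E l (x - y)| ^+ 2 = 4 * dotv (E l x) y.
  rewrite !projD projN -[in RHS](minxx l) -proj_min proj_symmetric.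
  by rewrite -polarization mulrC divfK.
by have := pol a; have := pol b; lra.
Qed.

(** A bounded integral over the line is determined by the intervals []a, b]], a
system that is closed under intersection and exhausts the line. *)
Lemma integral_unique (L1 L2 : (mR -> R) -> R) :
  bounded_integral L1 -> bounded_integral L2 ->
  (forall a b, a <= b -> L1 \1_`]a, b]%classic = L2 \1_`]a, b]%classic) ->
  forall p, bmeas p -> L1 p = L2 p.
Proof.
move=> b1 b2 L12.
apply: (@bounded_integral_unique _ mR _ (@ocitv R)) => //.
- by move=> A B; exact: (@measurableI _ (ocitv_type R)).
- have moc n : measurable_fun setT (\1_(`]- n%:R, n%:R]%classic) : mR -> R).
    exact: measurable_indic.
  have oc1 n (t : mR) : `|\1_(`]- n%:R, n%:R]%classic) t| <= 1 :> R.
    by rewrite indicE normr_nat; case: (_ \in _).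
  have := bint_lim b1 moc oc1 cvg_indic_oc.
  under eq_fun => n do rewrite L12 ?ge0_cp//.
  move/cvg_lim => <- //.
  by apply: cvg_lim => //; exact: bint_lim b2 _ _ _ moc oc1 cvg_indic_oc.
- move=> S [[a b] _ <-] /=.
  have [ab|/ltW ba] := leP a b; first exact: L12.
  rewrite set_itv_ge ?bnd_simp -?leNgt//.
  by have := L12 a a (lexx a); rewrite set_itvoc0.
Qed.

End calculus.

(** * Calculus of bounded functions *)

Section representation.
Context {R : realType} {V : preHilbertType R} (E : resolution V).
Notation mR := (measurableTypeR R).
Implicit Types (x y z : V) (a b l m : R) (p q : mR -> R) (P Q : V -> V).

Lemma spectral_integral_cst x a :
  \int[spectral_measure E x]_l a = a * `|x| ^+ 2.
Proof.
have e : fine (spectral_measure E x setT) = `|x| ^+ 2.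
  by rewrite -[RHS]/(fine _%:E) -(spectral_measureT E).
by rewrite Rintegral_cst// -e.
Qed.

Lemma spectral_form_diag p x : bmeas p ->
  spectral_form E p x x = \int[spectral_measure E x]_l p l.
Proof.
move: p; apply: integral_unique => [||a b ab].
- exact: bounded_integral_form.
- exact: bounded_integral_measure.
- rewrite spectral_form_indic// spectral_measure_indic//.
Qed.

Lemma spectral_formC p x y : bmeas p ->
  spectral_form E p x y = spectral_form E p y x.
Proof.
move: p; apply: integral_unique => [||a b ab].
1,2: exact: bounded_integral_form.
by rewrite !spectral_form_indic// !(dotvC _ x) -!proj_symmetric.
Qed.

Lemma spectral_form_linl p a x y z : bmeas p ->
  spectral_form E p (a *: x + y) z =
  a * spectral_form E p x z + spectral_form E p y z.
Proof.
move: p; apply: integral_unique => [||b c bc].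
- exact: bounded_integral_form.
- by apply: bounded_integral_lin; exact: bounded_integral_form.
- by rewrite !spectral_form_indic// !proj_linear !dotvDl !dotvZl; ring.
Qed.

Lemma spectral_form_linr p a x y z : bmeas p ->
  spectral_form E p z (a *: x + y) =
  a * spectral_form E p z x + spectral_form E p z y.
Proof. by move=> bp; rewrite !(spectral_formC z)// spectral_form_linl. Qed.

Lemma bmeas_half m : bmeas (\1_`]-oo, m]%classic : mR -> R).
Proof. exact: bmeas_indic. Qed.

(** [E m] restricts the measure of [(x, y)] to []-oo, m]], as the distribution
function of the pair [(x, E m y)] shows. *)
Lemma spectral_form_half p m x y : bmeas p ->
  spectral_form E p x (E m y) =
  spectral_form E (fun l => p l * \1_`]-oo, m]%classic l) x y.
Proof.
move: p; apply: integral_unique => [||a b ab].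
- exact: bounded_integral_form.
- apply: (bounded_integralM (bounded_integral_form E x y)); exact: bmeas_half.
- have -> : (fun l => \1_`]a, b]%classic l * \1_`]-oo, m]%classic l) =
      \1_`](Num.min a m), (Num.min b m)]%classic :> (mR -> R).
    rewrite -[LHS]/(_ \* _) -indicI; congr indic; apply/seteqP; split=> l /=.
      by rewrite !in_itv/= gt_min le_min => -[/andP[-> ->] ->].
    rewrite !in_itv/= gt_min le_min => /andP[alml /andP[-> lm]].
    by move: alml; rewrite lm (ltNge m) lm orbF => ->.
  have mab : Num.min a m <= Num.min b m.
    by rewrite le_min !ge_min ab lexx orbT.
  have e l : dotv (E l x) (E m y) = dotv (E (Num.min l m) x) y.
    by rewrite minC -proj_min [RHS]proj_symmetric.
  by rewrite !spectral_form_indic// !e.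
Qed.


(** [P] is the operator [p(A)]. *)
Definition represents p P :=
  bmeas p /\ forall x y, dotv (P x) y = spectral_form E p x y.

Lemma represents_sym p P x y : represents p P -> dotv (P x) y = dotv x (P y).
Proof. by move=> [bp pP]; rewrite pP spectral_formC// -pP dotvC. Qed.

Lemma represents_lin p P a x y : represents p P ->
  P (a *: x + y) = a *: P x + P y.
Proof.
move=> [bp pP]; apply: dotv_ext => z.
by rewrite dotvDl dotvZl !pP spectral_form_linl.
Qed.

Lemma represents_unique p P Q x : represents p P -> represents p Q -> P x = Q x.
Proof. by move=> [_ pP] [_ pQ]; apply: dotv_ext => z; rewrite pP pQ. Qed.

Lemma represents_id : represents (cst 1) id.
Proof.
split; first exact: bmeas_cst.
move=> x y; rewrite /spectral_form.
by rewrite !spectral_integral_cst !mul1r polarization.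
Qed.

Lemma represents_comb p q P Q a : represents p P -> represents q Q ->
  represents (fun l => a * p l + q l) (fun x => a *: P x + Q x).
Proof.
move=> [bp pP] [bq qQ]; split=> [|x y]; first exact: bmeas_lin.
by rewrite (bint_lin (bounded_integral_form E x y))// dotvDl dotvZl pP qQ.
Qed.

(** The measure of the pair [(Q x, y)] has density [q] with respect to that of
[(x, y)], since its distribution function is [dotv (Q x) (E m y)]. *)
Lemma spectral_form_comp p q Q x y : bmeas p -> represents q Q ->
  spectral_form E p (Q x) y = spectral_form E (fun l => p l * q l) x y.
Proof.
move=> bp [bq qQ]; move: p bp; apply: integral_unique => [||a b ab].
- exact: bounded_integral_form.
- exact: (bounded_integralM (bounded_integral_form E x y)).
have oc l : \1_`]a, b]%classic l =
    -1 * \1_`]-oo, a]%classic l + \1_`]-oo, b]%classic l :> R.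
  rewrite !indicE !mem_setE !in_itv/=.
  have [la|al] := leP l a; last by case: (l <= b) => /=; lra.
  by rewrite (le_trans la ab)/=; lra.
have -> : (fun l => \1_`]a, b]%classic l * q l) =
    (fun l => -1 * (q l * \1_`]-oo, a]%classic l) +
      q l * \1_`]-oo, b]%classic l).
  by apply/funext => l; rewrite oc; ring.
rewrite spectral_form_indic// (bint_lin (bounded_integral_form E x y)).
- by rewrite -!spectral_form_half// -!qQ -!proj_symmetric; ring.
- by apply: bmeasM => //; exact: bmeas_half.
- by apply: bmeasM => //; exact: bmeas_half.
Qed.

Lemma represents_comp p q P Q : represents p P -> represents q Q ->
  represents (fun l => p l * q l) (P \o Q).
Proof.
move=> [bp pP] rQ; split=> [|x y /=]; first exact/bmeasM/rQ.1.
by rewrite pP (spectral_form_comp _ _ bp rQ).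
Qed.

Lemma spectral_integral_comp p q Q x : bmeas p -> represents q Q ->
  \int[spectral_measure E (Q x)]_l p l =
  \int[spectral_measure E x]_l (p l * q l * q l).
Proof.
move=> bp rQ; have [bq _] := rQ; have bpq := bmeasM bp bq.
rewrite -(spectral_form_diag (Q x) bp) -(spectral_form_diag x (bmeasM bpq bq)).
rewrite (spectral_form_comp x (Q x) bp rQ) (spectral_formC x (Q x) bpq).
exact: spectral_form_comp.
Qed.

Lemma represents_iter p P n : represents p P ->
  represents (fun l => p l ^+ n) (iter n P).
Proof.
move=> rP; elim: n => [|n IH].
  by under eq_fun do rewrite expr0; exact: represents_id.
by under eq_fun do rewrite exprS; exact: represents_comp.
Qed.

Lemma represents_norm p P x : represents p P ->
  `|P x| ^+ 2 = \int[spectral_measure E x]_l (p l ^+ 2).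
Proof.
move=> rP; have [b2 r2] := represents_iter 2 rP.
by rewrite -spectral_form_diag// -r2 sqr_normv /= -(represents_sym _ _ rP).
Qed.

(** By dominated convergence, since [`|P_ n x| ^+ 2] is the integral of
[p_ n ^+ 2]. *)
Lemma represents_cvg0 (p_ : nat -> mR -> R) (P_ : nat -> V -> V) (C : R) x :
  (forall n, represents (p_ n) (P_ n)) -> (forall n t, `|p_ n t| <= C) ->
  (forall t, p_ n t @[n --> \oo] --> 0) -> P_ n x @[n --> \oo] --> (0 : V).
Proof.
move=> rP pC p0; apply/norm_cvg0P.
have h : `|P_ n x| ^+ 2 @[n --> \oo] --> (0 : R).
  under eq_fun do rewrite (represents_norm _ (rP _)).
  have -> : 0 = \int[spectral_measure E x]_l (fun=> 0) l :> R.
    by rewrite /Rintegral integral0.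
  apply: (@bint_lim _ _ _ _ (bounded_integral_measure E x) _ _ (C ^+ 2)).
  - by move=> n; have [mp _] := bmeasX 2 (rP n).1.
  - by move=> n t; rewrite normrX ler_pXn2r ?nnegrE// (le_trans _ (pC n t)).
  - by move=> t; have := cvgM (p0 t) (p0 t); rewrite mulr0; apply.
have := continuous_cvg _ (@sqrt_continuous R 0) h; rewrite sqrtr0 => /(_ _).
rewrite (_ : Num.sqrt \o _ = fun n => `|P_ n x|); first exact.
by apply/funext => n /=; rewrite sqrtr_sqr normr_id.
Qed.

(** The weak definition of [p(A) x] is a bounded linear form, which Riesz's
theorem represents. *)
Theorem represents_exists p : cauchy_complete V -> bmeas p ->
  exists P, represents p P.
Proof.
move=> cV bp; suff /choice[P PP] : forall x, exists z, forall y,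
  dotv z y = spectral_form E p x y by exists P; split.
move=> x; have [_ [C pC]] := bp.
have ile z : `|\int[spectral_measure E z]_l p l| <= C * `|z| ^+ 2.
  apply: (le_trans (le_normr_Rintegral _ (bounded_integrable E z bp))) => //.
  rewrite -spectral_integral_cst.
  apply: le_Rintegral => //.
  - have := bounded_integrable E z bp; exact: integrable_norm.
  - by have := bounded_integrable E z (bmeas_cst C).
pose F y := spectral_form E p x y.
have Fle y : `|F y| <= C * (`|x| ^+ 2 + `|y| ^+ 2) / 2.
  have := ile (x + y); have := ile (x - y); rewrite !sqr_normvD dotvNr normrN.
  rewrite /F /spectral_form; move: (Rintegral _ _ _) (Rintegral _ _ _).
  by move=> r s; rewrite !ler_norml; lra.
have Flin a y y' : F (a *: y + y') = a * F y + F y'.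
  exact: spectral_form_linr.
suff /(riesz_representation cV Flin)[z zF] :
  forall y, `|F y| <= C * (`|x| ^+ 2 + 1) / 2 * `|y| by exists z.
move=> y; have F0 : F 0 = 0.
  by have := Flin (-1) 0 0; rewrite scaler0 addr0 mulN1r addNr.
have [->|y0] := eqVneq y 0; first by rewrite F0 !normr0 mulr0.
have ny0 : `|y| != 0 by rewrite normr_eq0.
set u := `|y|^-1 *: y.
have yu : y = `|y| *: u + 0 by rewrite addr0 scalerA divff// scale1r.
have u1 : `|u| = 1 by rewrite normrZ normfV normr_id mulVf.
rewrite {1}yu Flin F0 addr0 normrM normr_id mulrC ler_wpM2r//.
by have := Fle u; rewrite u1 expr1n.
Qed.

End representation.

(** * Positivity and the support of the spectral measures *)

Section positivity.
Context {R : realType} {V : preHilbertType R} (E : resolution V).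
Notation mR := (measurableTypeR R).
Implicit Types (x y z : V) (a b l m : R) (p q : mR -> R) (P Q : V -> V).

Lemma calculus_dom_bmeas p x : bmeas p -> calculus_dom E p x.
Proof.
move=> bp; have /(bounded_integrable E x) := bmeasX 2 bp.
exact: integrable_lty.
Qed.

Lemma calculusE p P x : represents E p P -> calculus E p x = P x.
Proof.
move=> [bp pP]; apply: xget_unique => [|z [_ zE]].
  by split; [exact: calculus_dom_bmeas|move=> y _; exact: pP].
apply: dotv_ext => y; rewrite pP; apply: zE; exact: calculus_dom_bmeas.
Qed.

Lemma measurable_idR : measurable_fun [set: mR] (fun l : mR => l : R).
Proof. exact: (@measurable_id _ mR setT). Qed.

(** For [x] in the range of [E b - E a] all the mass lies in []a, b]], so that
unbounded functions may be truncated outside. *)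
Lemma spectral_measure_concentrated a b x : a <= b -> E a x = 0 -> E b x = x ->
  (spectral_measure E x).-negligible (~` `]a, b]).
Proof.
move=> ab ax bx; apply/negligibleP; first exact: measurableC.
rewrite -setTD measureD//= ?setTI.
- rewrite -[X in (X - _)%E]/(spectral_measure E x setT) spectral_measureT.
  rewrite -[X in (_ - X)%E]/(spectral_measure E x `]a, b]%classic).
  rewrite spectral_measure_oc// !spectral_cdfE ax bx normr0 expr0n subr0.
  by rewrite subee.
- by have := ltry (`|x| ^+ 2); rewrite -(spectral_measureT E).
Qed.

Lemma integral_concentrated a b x : a <= b -> E a x = 0 -> E b x = x ->
  \int[spectral_measure E x]_l l =
  \int[spectral_measure E x]_l (l * \1_`]a, b]%classic l).
Proof.
move=> ab ax bx; congr fine; apply: ae_eq_integral => //.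
- apply/measurable_EFinP; apply: measurable_funM; first exact: measurable_idR.
  exact: measurable_indic.
- have [N [mN N0 abN]] := spectral_measure_concentrated ab ax bx.
  exists N; split=> // l /= nl; apply: abN => /= lab; apply: nl => _.
  by rewrite indicE mem_set// mulr1.
Qed.

(** The vectors [E 0 x - E (- k) x] lie in the domain of [A] and the quadratic
form of [A] is nonpositive on them, so that they vanish; let [k] tend to
infinity. *)
Lemma positive_proj0 (A : linop V) : positive A -> associated E A ->
  forall x, E 0 x = 0.
Proof.
move=> pA [domA EA] x.
suff main (k : nat) : E 0 x = E (- k%:R) x.
  have nn : - (k%:R : R) @[k --> \oo] --> -oo by apply/cvgNrNy; exact: cvgr_idn.
  have := @cvg_comp _ _ _ _ (E ^~ x) _ _ _ nn (@proj_Ny _ _ E x).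
  rewrite (_ : _ \o _ = fun=> E 0 x); last first.
    by apply/funext => k /=; rewrite -main.
  by move/(cvg_unique _ (cvg_cst _)); apply.
pose y := E 0 x - E (- k%:R) x.
have k0 : - k%:R <= 0 :> R by rewrite oppr_le0.
have yk : E (- k%:R) y = 0.
  by rewrite projD projN !proj_min minxx min_l// subrr.
have y0 : E 0 y = y by rewrite projD projN !proj_min minxx min_r.
have domy : calculus_dom E id y.
  rewrite /calculus_dom/=; apply: (@le_lt_trans _ _
    (\int[spectral_measure E y]_l ((k%:R ^+ 2)%:E))%E); last first.
    rewrite integral_cst//.
    rewrite [X in (_ * X)%E](_ : _ = (`|y| ^+ 2)%:E) ?ltry//.
    exact: spectral_measureT.
  apply: ae_ge0_le_integral => //.
  - by move=> l _; rewrite lee_fin sqr_ge0.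
  - by apply/measurable_EFinP; apply: measurable_funX; exact: measurable_idR.
  have [N [mN N0 kN]] := spectral_measure_concentrated k0 yk y0.
  exists N; split=> // l /= nl; apply: kN => /= lk; apply: nl => _.
  move: lk; rewrite in_itv/= => /andP[kl l0].
  by rewrite lee_fin -[l ^+ 2]sqrrN ler_pXn2r ?nnegrE ?oppr_ge0// lerNl ltW.
have domAy : dom A y by rewrite domA.
apply/eqP; rewrite -subr_eq0 -/y; apply: contraT => yn0.
pose g (l : mR) : R := l * \1_`](- k%:R), 0]%classic l.
have bg : bmeas g.
  split.
    by apply: measurable_funM; [exact: measurable_idR|exact: measurable_indic].
  exists k%:R => l; rewrite /g indicE mem_setE in_itv/=.
  have [/andP[kl l0]|_] := boolP (- k%:R < l <= 0); last first.
    by rewrite mulr0 normr0.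
  by rewrite mulr1 ler0_norm// lerNl ltW.
have idg : spectral_form E id y y = spectral_form E g y y.
  rewrite /spectral_form (integral_concentrated k0).
  1: rewrite (integral_concentrated k0)//.
  - by rewrite projD projN yk subrr.
  - by rewrite projD projN y0.
  - by rewrite projD yk addr0.
  - by rewrite projD y0.
have := pA _ domAy yn0; rewrite (EA _ domAy y domy) idg.
rewrite spectral_form_diag// => g_gt0.
have : 0 <= \int[spectral_measure E y]_l (-1 * g l + cst 0 l).
  apply: Rintegral_ge0 => l _; rewrite /g addr0 mulN1r oppr_ge0 indicE mem_setE.
  rewrite in_itv/=; have [/andP[kl l0]|_] := boolP (- k%:R < l <= 0).
    by rewrite mulr1.
  by rewrite mulr0.
rewrite (bint_lin (bounded_integral_measure E y))//; last exact: bmeas_cst.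
rewrite spectral_integral_cst mul0r addr0 mulN1r oppr_ge0.
by move/(lt_le_trans g_gt0); rewrite ltxx.
Qed.

End positivity.

(** * The isometry between the pivot space and [H^s] *)

Section sobolev.
Context {R : realType} {V : preHilbertType R} (E : resolution V).
Notation mR := (measurableTypeR R).
Implicit Types (x y z : V) (a b l m : R) (p q : mR -> R) (P Q : V -> V).
Hypothesis E0 : forall x, E 0 x = 0.

(** The measures vanish on []-oo, 0]], restriction to which amounts to applying
[E 0]. *)
Lemma spectral_form_pos p q x y : bmeas p -> bmeas q ->
  (forall l, 0 < l -> p l = q l) ->
  spectral_form E p x y = spectral_form E q x y.
Proof.
have half g : bmeas g ->
    spectral_form E (fun l => g l * \1_`]-oo, 0%R]%classic l) x y = 0.
  move=> bg; rewrite -spectral_form_half// E0.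
  have := spectral_form_linr E (-1) 0 0 x bg.
  by rewrite scaler0 addr0 mulN1r addNr.
move=> bp bq pq; have bL := bounded_integral_form E x y.
have bh : bmeas (\1_`]-oo, 0%R]%classic : mR -> R) by exact: bmeas_half.
have cut g : bmeas g -> spectral_form E g x y =
    spectral_form E (fun l => -1 * (g l * \1_`]-oo, 0%R]%classic l) + g l) x y.
  move=> bg; rewrite (bint_lin bL)// ?half ?mulr0 ?add0r//; exact: bmeasM.
rewrite (cut p)// (cut q)//; congr spectral_form; apply/funext => l.
rewrite indicE mem_setE in_itv/=; have [l0|l0] := leP l 0.
  by rewrite !mulr1 !mulN1r !addNr.
by rewrite pq.
Qed.

Lemma represents_pos p q P : represents E p P -> bmeas q ->
  (forall l, 0 < l -> p l = q l) -> represents E q P.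
Proof.
move=> [bp pP] bq pq; split=> // x y.
by rewrite pP; exact: spectral_form_pos.
Qed.

Variables (s : R) (s0 : 0 <= s).

Let u (l : mR) : R := 1 + l ^+ 2.
Let w (l : mR) : R := u l `^ s.
Let v (l : mR) : R := u l `^ (s / 2).
Let r (l : mR) : R := u l `^ - (s / 2).
Let cut n : set mR := `[0, n%:R]%classic.
Let wn n (l : mR) : R := w l * \1_(cut n) l.
Let vn n (l : mR) : R := v l * \1_(cut n) l.

Let u1 l : 1 <= u l. Proof. by rewrite lerDl sqr_ge0. Qed.
Let u_gt0 l : 0 < u l. Proof. exact: lt_le_trans (u1 l). Qed.

Let vv l : v l * v l = w l.
Proof.
have un0 : u l != 0 by rewrite gt_eqF.
by rewrite /v -powRD ?un0 ?implybT// -splitr.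
Qed.

Let rv l : r l * v l = 1.
Proof. by rewrite /r powRN mulVf// gt_eqF// powR_gt0. Qed.

Let mpow c : measurable_fun setT (fun l : mR => u l `^ c).
Proof.
apply: (measurableT_comp (measurable_powR c)).
apply: measurable_funD => //; apply: measurable_funX; exact: measurable_idR.
Qed.

Let bcut c n : 0 <= c -> bmeas (fun l => u l `^ c * \1_(cut n) l).
Proof.
move=> c0; split.
  apply: measurable_funM; first exact: mpow.
  by apply: measurable_indic; exact: measurable_itv.
exists ((1 + n%:R ^+ 2) `^ c) => l; rewrite indicE mem_setE in_itv/=.
have [/andP[l0 ln]|_] := boolP (0 <= l <= n%:R).
  rewrite mulr1 ger0_norm ?powR_ge0// ge0_ler_powR ?nnegrE ?(ltW (u_gt0 _))//.
  by rewrite lerD2l ler_pXn2r ?nnegrE.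
by rewrite mulr0 normr0 powR_ge0.
Qed.

Let bwn n : bmeas (wn n). Proof. exact: bcut. Qed.
Let bvn n : bmeas (vn n). Proof. by apply: bcut; rewrite divr_ge0. Qed.

Let br : bmeas r.
Proof.
split; first exact: mpow.
exists 1 => l; rewrite ger0_norm ?powR_ge0// /r powRN invf_le1 ?powR_gt0//.
have e1 : 1 = 1 `^ (s / 2) :> R by rewrite powR1.
by rewrite [X in X <= _]e1 ge0_ler_powR ?nnegrE ?divr_ge0// ltW.
Qed.

Let bcut1 n : bmeas (\1_(cut n) : mR -> R).
Proof. by apply: bmeas_indic; exact: measurable_itv. Qed.

Let cvg_cut (l : mR) :
  \1_(cut n) l @[n --> \oo] --> (\1_(`[0, +oo[%classic) l : R).
Proof.
apply: cvg_near_cst; near=> n; rewrite !indicE !mem_setE !in_itv/= andbT.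
suff -> : l <= n%:R by rewrite andbT.
by near: n; exact: nbhs_infty_ger.
Unshelve. all: by end_near. Qed.

Let cvg_wn x : (\int[spectral_measure E x]_l wn n l)%:E @[n --> \oo] -->
  Hs_sqnorm E s x.
Proof.
have cutE : `[0, +oo[%classic = \bigcup_n cut n :> set mR.
  apply/seteqP; split=> l /=; rewrite in_itv/= andbT.
    move=> l0; exists (Num.bound l) => //; rewrite /cut/= in_itv/= l0/=.
    exact: ltW (archi_boundP l0).
  by move=> [n _]; rewrite /cut /= in_itv/= => /andP[].
rewrite /Hs_sqnorm cutE.
have -> : (fun n => (\int[spectral_measure E x]_l wn n l)%:E) =
    (fun n => (\int[spectral_measure E x]_(l in cut n) (w l)%:E)%E).
  apply/funext => n; rewrite [RHS]integral_mkcond /Rintegral fineK.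
    by apply: eq_integral => l _; rewrite epatch_indic.
  by apply: integrable_fin_num => //; exact: bounded_integrable.
apply: ge0_nondecreasing_set_cvg_integral => //.
- move=> m n mn; apply/subsetPset => l.
  rewrite /cut/= !in_itv/= => /andP[-> lm].
  by rewrite (le_trans lm)// ler_nat.
- by move=> n; exact: measurable_itv.
- by move=> n; apply/measurable_EFinP; apply: measurable_funTS; exact: mpow.
- by move=> n l _; rewrite lee_fin powR_ge0.
Qed.

Section isometry.
Variables (J : V -> V) (rJ : represents E r J).

(** The weight [w] cancels the density [r ^+ 2] of the measure of [J y] with
respect to that of [y]. *)
Lemma Hs_sqnorm_iso y : Hs_sqnorm E s (J y) = (`|y| ^+ 2)%:E.
Proof.
have e n : \int[spectral_measure E (J y)]_l wn n l =
    \int[spectral_measure E y]_l \1_(cut n) l.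
  rewrite (spectral_integral_comp _ (bwn n) rJ); apply: eq_Rintegral => l _.
  by rewrite /wn -vv -[RHS]mul1r -[1](mulr1 1) -{1}(rv l) -(rv l); ring.
suff h : (\int[spectral_measure E (J y)]_l wn n l)%:E @[n --> \oo] -->
    (`|y| ^+ 2)%:E.
  exact: cvg_unique (@cvg_wn (J y)) h.
under eq_fun do rewrite e.
apply: cvg_EFin; first exact: nearW.
have b0 : bmeas (\1_(`[0, +oo[%classic) : mR -> R).
  by apply: bmeas_indic; exact: measurable_itv.
have -> : `|y| ^+ 2 = \int[spectral_measure E y]_l \1_(`[0, +oo[%classic) l.
  rewrite -spectral_form_diag//.
  rewrite (@spectral_form_pos _ (cst 1) y y b0 (bmeas_cst 1)).
    rewrite spectral_form_diag ?spectral_integral_cst ?mul1r//.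
    exact: bmeas_cst.
  by move=> l l0; rewrite indicE mem_set//= in_itv/= (ltW l0).
apply: (@bint_lim _ _ _ _ (bounded_integral_measure E y) _ _ 1).
- by move=> n; have [] := bcut1 n.
- by move=> n l; rewrite indicE normr_nat; case: (_ \in _).
- exact: cvg_cut.
Qed.

(** The preimage of [x] is [v(A) x], where [v = r^-1] is unbounded. It is the limit
of the vectors obtained by truncating [v] to [[0, n]], which are Cauchy because
the truncated integrals of [v ^+ 2] increase to the finite square norm of [x]. *)
Lemma Hs_iso_onto x : cauchy_complete V -> Hs E s x -> exists y, x = J y.
Proof.
move=> cV; rewrite /Hs /= => xs.
pose a n := \int[spectral_measure E x]_l wn n l.
have /choice[L rL] n : exists P, represents E (vn n) P.
  exact: represents_exists.
have cutM (m n : nat) (l : mR) : (m <= n)%N ->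
    \1_(cut m) l * \1_(cut n) l = \1_(cut m) l :> R.
  move=> mn; rewrite !indicE /cut !mem_setE !in_itv/=.
  have [/andP[l0 lm]|_] := boolP (0 <= l <= m%:R); last by rewrite mul0r.
  by rewrite l0 (le_trans lm) ?ler_nat// mulr1.
have nL (m n : nat) : (m <= n)%N -> `|L m x - L n x| ^+ 2 = a n - a m.
  move=> mn; have rmn := represents_comb (-1) (rL m) (rL n).
  have := represents_norm x rmn; rewrite scaleN1r -normrN opprD opprK => ->.
  have -> : a n - a m = \int[spectral_measure E x]_l (-1 * wn m l + wn n l).
    by rewrite (bint_lin (bounded_integral_measure E x))// mulN1r addrC.
  apply: eq_Rintegral => l _; rewrite /wn /vn -vv.
  transitivity (v l ^+ 2 * (\1_(cut m) l * \1_(cut m) l)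
    - 2 * v l ^+ 2 * (\1_(cut m) l * \1_(cut n) l)
    + v l ^+ 2 * (\1_(cut n) l * \1_(cut n) l)); first by ring.
  by rewrite !cutM//; ring.
have ac : a n @[n --> \oo] --> fine (Hs_sqnorm E s x).
  have xfin : Hs_sqnorm E s x \is a fin_num.
    by rewrite ge0_fin_numE// integral_ge0// => l _; rewrite lee_fin powR_ge0.
  by have := @cvg_wn x; rewrite -(fineK xfin) => /fine_cvg.
have [y Ly] : exists y : V, L n x @[n --> \oo] --> y.
  apply: cV => e e0; have e20 : 0 < e ^+ 2 / 2 by rewrite divr_gt0// exprn_gt0.
  move/cvgrPdist_lt : ac => /(_ _ e20)[N _ NP].
  exists N.
  suff main (m n : nat) : (N <= m)%N -> (m <= n)%N -> `|L m x - L n x| < e.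
    move=> m n Nm Nn; have [mn|/ltnW nm] := leqP m n; first exact: main.
    by rewrite distrC; exact: main.
  move=> Nm mn; rewrite -(@ltr_pXn2r _ 2) ?nnegrE ?(ltW e0)// nL//.
  have := NP m Nm; have := NP n (leq_trans Nm mn).
  by rewrite /= !ltr_norml => /andP[? ?] /andP[? ?]; lra.
exists y; apply: dotv_ext => z.
(* [q n] is the indicator of []n, +oo[]; it represents [x - J (L n x)] because
   only the values at positive arguments count *)
pose q n (l : mR) : R := -1 * \1_(`]-oo, n%:R]%classic) l + cst 1 l.
have rq n : represents E (q n) (fun x => -1 *: J (L n x) + x).
  have := represents_comb (-1) (represents_comp rJ (rL n)) (represents_id E).
  move/represents_pos; apply.
    by apply: bmeas_lin; [exact: bmeas_half|exact: bmeas_cst].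
  move=> l l0; rewrite /q /vn (mulrA (r l)) rv mul1r !indicE /cut !mem_setE.
  by rewrite !in_itv/= (ltW l0).
have h0 : -1 *: J (L n x) + x @[n --> \oo] --> (0 : V).
  pose q_op n x := -1 *: J (L n x) + x.
  apply: (@represents_cvg0 _ _ _ q q_op 1 x rq) => [n l|l].
    rewrite /q /= indicE; case: (_ \in _) => /=.
      by rewrite mulr1 addNr normr0.
    by rewrite mulr0 add0r normr1.
  apply: cvg_near_cst; near=> n; rewrite /q indicE mem_set/= ?mulr1 ?addNr//.
  by rewrite in_itv/=; near: n; exact: nbhs_infty_ger.
have h1 : - dotv (L n x) (J z) + dotv x z @[n --> \oo] --> (0 : R).
  have := @cvg_dotvl _ _ _ _ z h0; rewrite dotv0l.
  by under eq_fun do rewrite dotvDl dotvZl mulN1r (represents_sym _ _ rJ).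
have h2 : - dotv (L n x) (J z) + dotv x z @[n --> \oo] -->
    - dotv y (J z) + dotv x z.
  by apply: cvgD; [apply: cvgN; exact: cvg_dotvl|exact: cvg_cst].
have h12 : - dotv y (J z) + dotv x z = 0 by exact: cvg_unique h2 h1.
move/eqP: h12; rewrite addrC subr_eq0 -(represents_sym _ _ rJ).
by move/eqP.
Unshelve. all: by end_near. Qed.

End isometry.

Theorem Hs_isometry : cauchy_complete V -> exists r J,
  [/\ represents E r J, forall y, Hs_sqnorm E s (J y) = (`|y| ^+ 2)%:E &
      forall x, Hs E s x -> exists y, x = J y].
Proof.
move=> cV; have [J rJ] := represents_exists E cV br.
exists r, J; split=> // [y|x]; [exact: Hs_sqnorm_iso|exact: Hs_iso_onto].
Qed.

End sobolev.

(** * Forms on [H^s] as vectors of the pivot space *)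

Section dual.
Context {R : realType} {V : preHilbertType R} (E : resolution V) (s : R).
Implicit Types (x y z : V) (F G : Hneg E s).
Hypothesis cV : cauchy_complete V.
Variable J : V -> V.
Hypothesis Jlin : forall a x y, J (a *: x + y) = a *: J x + J y.
Hypothesis HsJ : forall y, Hs_sqnorm E s (J y) = (`|y| ^+ 2)%:E.
Hypothesis Jonto : forall x, Hs E s x -> exists y, x = J y.

Let HsJy y : Hs E s (J y). Proof. by rewrite /Hs/= HsJ ltry. Qed.

Let Hs_normJ y : Hs_norm E s (J y) = `|y|.
Proof. by rewrite /Hs_norm HsJ/= sqrtr_sqr normr_id. Qed.

Let Hs_lin a x y : Hs E s x -> Hs E s y -> Hs E s (a *: x + y).
Proof. by move=> /Jonto[x' ->] /Jonto[y' ->]; rewrite -Jlin. Qed.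

Let Hneg_lin F a x y : F (J (a *: x + y)) = a * F (J x) + F (J y).
Proof.
by have /asboolP[Flin _ _] := formP F; rewrite Jlin Flin.
Qed.

Lemma Hneg_out F x : ~ Hs E s x -> F x = 0.
Proof. by have /asboolP[_ _ F0] := formP F; exact: F0. Qed.

Lemma Hneg_riesz_ex F : exists f, forall y, F (J y) = dotv f y.
Proof.
have /asboolP[_ [C FC] _] := formP F.
apply: (@riesz_representation _ _ (fun y => F (J y)) C cV).
  by move=> a x y; exact: Hneg_lin.
by move=> y; rewrite -[`|y|]Hs_normJ; exact: FC.
Qed.

(** [F] pulled back along [J] is the scalar product with this vector; it realizes
[H^-s] isometrically as the pivot space. *)
Definition Hneg_vector F : V := sval (cid (Hneg_riesz_ex F)).

Lemma Hneg_vectorE F y : F (J y) = dotv (Hneg_vector F) y.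
Proof. by rewrite /Hneg_vector; case: cid. Qed.

Lemma Hneg_vectorP F f : (forall y, F (J y) = dotv f y) -> Hneg_vector F = f.
Proof. by move=> Ff; apply: dotv_ext => z; rewrite -Hneg_vectorE Ff. Qed.

Lemma Hneg_vectorD F G : Hneg_vector (F + G) = Hneg_vector F + Hneg_vector G.
Proof. by apply: Hneg_vectorP => y; rewrite dotvDl -!Hneg_vectorE. Qed.

Lemma Hneg_vectorB F G : Hneg_vector (F - G) = Hneg_vector F - Hneg_vector G.
Proof. by apply: Hneg_vectorP => y; rewrite dotvBl -!Hneg_vectorE. Qed.

Lemma Hneg_ext F G : (forall x, F x = G x) -> F = G.
Proof. by move=> FG; apply/val_inj/funext. Qed.

Lemma Hneg_vector_inj : injective Hneg_vector.
Proof.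
move=> F G FG; apply: Hneg_ext => x.
have [/Jonto[y ->]|nx] := pselect (Hs E s x); first by rewrite !Hneg_vectorE FG.
by rewrite !Hneg_out.
Qed.

(** By Cauchy-Schwarz; the supremum is attained at the normalized vector. *)
Lemma Hneg_norm_vector F : Hneg_norm F = `|Hneg_vector F|.
Proof.
set f := Hneg_vector F; rewrite /Hneg_norm; set S := [set _ | _ in _].
have ubS : ubound S `|f|.
  move=> _ [_ [/Jonto[y ->]]] /[swap] <-; rewrite Hs_normJ => y1.
  rewrite Hneg_vectorE (le_trans (cauchy_schwarz _ _))//.
  by rewrite ler_piMr.
have S0 : S 0.
  exists (J 0); last by rewrite Hneg_vectorE dotv0r normr0.
  by split => //; rewrite Hs_normJ normr0.
apply/eqP; rewrite eq_le ge_sup//=; last by exists 0.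
have [->|f0] := eqVneq f 0; first by rewrite normr0 ub_le_sup//; exists `|f|.
apply: ub_le_sup; first by exists `|f|.
exists (J (`|f|^-1 *: f)).
  by split => //=; rewrite Hs_normJ normrZ normfV normr_id mulVf ?normr_eq0.
rewrite Hneg_vectorE dotvZr -sqr_normv expr2 mulKf ?normr_eq0//.
exact: normr_id.
Qed.

Lemma Hneg_dot_vector F G :
  Hneg_dot F G = dotv (Hneg_vector F) (Hneg_vector G).
Proof.
by rewrite /Hneg_dot !Hneg_norm_vector Hneg_vectorD Hneg_vectorB polarization.
Qed.

Section transpose.
Variable B : V -> V.
Hypothesis Blin : forall a x y, B (a *: x + y) = a *: B x + B y.
Hypothesis Bsym : forall x y, dotv (B x) y = dotv x (B y).
Hypothesis Bnorm : forall x, `|B x| <= `|x|.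
Hypothesis BJ : forall y, B (J y) = J (B y).

Let tform F x : R^o := if `[< Hs E s x >] then F (B x) else 0.

Let tformJ F y : tform F (J y) = dotv (B (Hneg_vector F)) y.
Proof.
rewrite /tform; case: asboolP => [_|/(_ (HsJy y))//].
by rewrite BJ Hneg_vectorE Bsym.
Qed.

Let tformP F : tform F \in Hs_form E s.
Proof.
apply/asboolP; split.
- move=> a x y /Jonto[x' ->] /Jonto[y' ->].
  by rewrite -Jlin !tformJ dotvDr dotvZr.
- exists `|B (Hneg_vector F)| => _ /Jonto[y ->].
  by rewrite tformJ Hs_normJ; exact: cauchy_schwarz.
- by move=> x nx; rewrite /tform; case: asboolP.
Qed.

(** Precomposition with [B], extended by [0] outside of [H^s] as the encoding of
forms requires. *)
Definition Hneg_transpose F : Hneg E s := HNeg (tformP F).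

Lemma Hneg_transposeE F x : Hs E s x -> Hneg_transpose F x = F (B x).
Proof. by move=> xs; rewrite /= /tform asboolT. Qed.

(** [B] is its own transpose and commutes with [J]. *)
Lemma Hneg_transpose_vector F :
  Hneg_vector (Hneg_transpose F) = B (Hneg_vector F).
Proof. by apply: Hneg_vectorP => y; exact: tformJ. Qed.

Lemma Hneg_transpose_linear : linear Hneg_transpose.
Proof.
move=> a F G; apply: Hneg_ext => x.
have [xs|nx] := pselect (Hs E s x); last by rewrite !Hneg_out.
rewrite Hneg_transposeE//.
rewrite -[RHS]/(a * Hneg_transpose F x + Hneg_transpose G x).
by rewrite !Hneg_transposeE.
Qed.

HB.instance Definition _ := GRing.isLinear.Build R (Hneg E s) (Hneg E s) _
  Hneg_transpose Hneg_transpose_linear.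

End transpose.
End dual.

(** * The operator [tanh (A T) ^ 2] *)

Section tanh.
Context {R : realType}.
Implicit Types x : R.

Lemma tanh_den_gt0 x : 0 < expR x + expR (- x).
Proof. by rewrite addr_gt0 ?expR_gt0. Qed.

Lemma tanh_gt0 x : 0 < x -> 0 < tanh x.
Proof.
move=> x0; rewrite divr_gt0 ?tanh_den_gt0// subr_gt0 ltr_expR.
by rewrite (lt_trans _ x0)// oppr_lt0.
Qed.

Lemma normr_tanh_lt1 x : `|tanh x| < 1.
Proof.
rewrite /tanh normrM normfV (gtr0_norm (tanh_den_gt0 x)).
rewrite ltr_pdivrMr ?tanh_den_gt0//.
rewrite mul1r ltr_norml; have := expR_gt0 x; have := expR_gt0 (- x).
by move=> ? ?; apply/andP; split; lra.
Qed.

Lemma continuous_tanh : continuous (@tanh R).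
Proof.
move=> x; have cN : - y @[y --> x] --> - x by apply: cvgN; exact: cvg_id.
have ce : expR (- y) @[y --> x] --> expR (- x).
  by apply: (cvg_comp _ _ cN); exact: continuous_expR.
apply: cvgM; first by apply: cvgB => //; exact: continuous_expR.
apply: cvgV; first by rewrite gt_eqF// tanh_den_gt0.
by apply: cvgD => //; exact: continuous_expR.
Qed.

End tanh.

Section main.
Context {R : realType} {V : preHilbertType R} (E : resolution V).
Notation mR := (measurableTypeR R).

Lemma bmeas_tanh (T : R) : bmeas (fun l : mR => tanh (l * T)).
Proof.
split; last by exists 1 => l; exact/ltW/normr_tanh_lt1.
have : measurable_fun setT (fun l : R => tanh (l * T)).
  apply: continuous_measurable_fun => l.
  apply: (@continuous_comp R R R (fun l => l * T)); last exact: continuous_tanh.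
  by apply: cvgM; [exact: cvg_id|exact: cvg_cst].
exact.
Qed.

(** [x] is the limit of the constant sequence of its iterates, and [p ^+ n] tends
to [0]. *)
Lemma represents_fixed (p : mR -> R) P x : represents E p P ->
  (forall l, 0 <= p l < 1) -> P x = x -> x = 0.
Proof.
move=> rP p01 Px.
have : iter n P x @[n --> \oo] --> (0 : V).
  apply: (@represents_cvg0 _ _ _ (fun n l => p l ^+ n) (fun n => iter n P) 1 x).
  - by move=> n; exact: represents_iter n rP.
  - move=> n l; have /andP[p0 /ltW p1] := p01 l.
    by rewrite ger0_norm ?exprn_ge0// exprn_ile1.
  - by move=> l; have /andP[p0 p1] := p01 l; apply: cvg_expr; rewrite ger0_norm.
have -> : (fun n => iter n P x) = fun=> x.
  by apply/funext; elim=> //= n ->.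
by move/(cvg_unique _ (cvg_cst _)); apply.
Qed.

(** In terms of the vectors of forms, the operator is [B = t \o t] and every
assertion is one about [B] on the pivot space. *)
Theorem tanh_sqr_extension (A : linop V) (T : R) : cauchy_complete V ->
  positive A -> associated E A -> 0 < T ->
  let tanhAT := calculus E (fun l => tanh (l * T)) in
  exists Tle : {linear Hneg E 2^-1 -> Hneg E 2^-1},
    [/\ extension (tanhAT \o tanhAT) Tle,
        op_positive (@Hneg_dot _ _ E 2^-1) Tle,
        op_self_adjoint (@Hneg_dot _ _ E 2^-1) Tle &
        injective Tle] /\
    [/\ regular_asymptotic (@Hneg_norm _ _ E 2^-1) Tle,
        nonexpansive (@Hneg_norm _ _ E 2^-1) Tle &
        ~ point_spectrum Tle 1].
Proof.
move=> cV pA EA T0 tanhAT.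
have E0 := positive_proj0 pA EA.
have [t rt] := represents_exists E cV (bmeas_tanh T).
have s0 : 0 <= 2^-1 :> R by [].
have [r [J [rJ HsJ Jonto]]] := Hs_isometry E0 s0 cV.
have Jlin a x y := represents_lin a x y rJ.
pose b (l : mR) : R := tanh (l * T) * tanh (l * T).
pose B := t \o t.
have rB : represents E b B by exact: represents_comp.
have b01 l : 0 <= b l < 1.
  rewrite /b -expr2 sqr_ge0/= -real_normK ?num_real// expr_lt1//.
  exact: normr_tanh_lt1.
have tB : tanhAT \o tanhAT = B.
  have tE : tanhAT = t by apply/funext => x; exact: calculusE.
  by rewrite tE.
have Blin a x y := represents_lin a x y rB.
have Bsym x y := represents_sym x y rB.
have BJ y : B (J y) = J (B y).
  have rJB : represents E (fun l => b l * r l) (J \o B).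
    have -> : (fun l => b l * r l) = (fun l => r l * b l).
      by apply/funext => l; rewrite mulrC.
    exact: represents_comp.
  exact: represents_unique y (represents_comp rB rJ) rJB.
have Bnorm x : `|B x| <= `|x|.
  rewrite -(@ler_pXn2r _ 2) ?nnegrE// (represents_norm _ rB).
  rewrite -[leRHS]mul1r -(spectral_integral_cst E); apply: le_Rintegral => //.
  - exact/bounded_integrable/bmeasX/rB.1.
  - exact/bounded_integrable/bmeas_cst.
  - by move=> l _; have /andP[? /ltW ?] := b01 l; rewrite exprn_ile1.
have B_eq0 x : B x = 0 -> x = 0.
  (* [1 - b] equals 1 at the origin, where [tanh] vanishes, so it is cut off
     outside of the support of the spectral measures *)
  pose q (l : mR) : R := (-1 * b l + cst 1 l) * \1_(`]0, +oo[%classic) l.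
  move=> Bx0; apply: (@represents_fixed q (fun x => -1 *: B x + x)).
  - have rq := represents_comb (-1) rB (represents_id E).
    apply: (represents_pos E0 rq) => [|l l0]; last first.
      by rewrite /q indicE mem_set/= ?mulr1// in_itv/= l0.
    by apply: bmeasM; [exact: rq.1|apply: bmeas_indic; exact: measurable_itv].
  - move=> l; rewrite /q indicE mem_setE in_itv/= andbT.
    have [l0|_] := boolP (0 < l); last by rewrite mulr0 lexx ltr01.
    have := b01 l; have : 0 < b l by rewrite mulr_gt0// tanh_gt0// mulr_gt0.
    by rewrite mulr1 mulN1r => b0 /andP[_ b1]; apply/andP; split; lra.
  - by rewrite Bx0 scaler0 add0r.
pose Tle : {linear Hneg E 2^-1 -> Hneg E 2^-1} :=
  Hneg_transpose cV Jlin HsJ Jonto Bsym BJ.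
pose vec := @Hneg_vector _ _ E 2^-1 cV J Jlin HsJ.
have vecT F : vec (Tle F) = B (vec F) by exact: Hneg_transpose_vector.
have vec_dot F G : Hneg_dot F G = dotv (vec F) (vec G).
  exact: Hneg_dot_vector.
have vec_norm F : Hneg_norm F = `|vec F| by exact: Hneg_norm_vector.
have vec_inj : injective vec by exact: Hneg_vector_inj.
have vec0 : vec 0 = 0 by apply: Hneg_vectorP => y; rewrite dotv0l.
have TleE F x : Hs E 2^-1 x -> Tle F x = F (B x) by exact: Hneg_transposeE.
have HsB x : Hs E 2^-1 x -> Hs E 2^-1 (B x).
  by move=> /Jonto[y ->]; rewrite BJ /Hs/= HsJ ltry.
have vec_eq0 F : vec F = 0 -> F = 0 by rewrite -vec0 => /vec_inj.
exists Tle; rewrite tB; split; split.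
- split=> // F y Fy x xs.
  rewrite (TleE F x xs) (Fy _ (HsB x xs)); exact: esym (Bsym y x).
- move=> F F0.
  rewrite vec_dot vecT [dotv _ _](represents_sym _ _ rt) -sqr_normv.
  rewrite exprn_gt0// normr_gt0; apply: contra_neq F0 => tF0.
  apply/vec_eq0/B_eq0; rewrite /B /= tF0.
  by have := represents_lin (-1) 0 0 rt; rewrite scaler0 addr0 scaleN1r addNr.
- by move=> F G; rewrite !vec_dot !vecT Bsym.
- move=> F G FG; apply/eqP; rewrite -subr_eq0; apply/eqP/vec_eq0/B_eq0.
  by rewrite -vecT linearB FG subrr.
- move=> F.
  have vec_iter k : vec (iter k Tle F) = iter k B (vec F).
    by elim: k => //= k IH; rewrite vecT IH.
  have : -1 *: iter k B (vec F) + iter k.+1 B (vec F) @[k --> \oo] --> (0 : V).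
    apply: (@represents_cvg0 _ _ _ (fun k l => -1 * b l ^+ k + b l ^+ k.+1)
      (fun k x => -1 *: iter k B x + iter k.+1 B x) 1 (vec F)).
    + move=> k.
      exact: represents_comb (represents_iter k rB) (represents_iter k.+1 rB).
    + move=> k l; have /andP[b0 b1] := b01 l; have b1' := ltW b1.
      have := exprn_ile1 k b0 b1'; have := exprn_ge0 k b0.
      have := exprn_ile1 k.+1 b0 b1'; have := exprn_ge0 k.+1 b0.
      by rewrite ler_norml => ? ? ? ?; apply/andP; split; lra.
    + move=> l; have /andP[b0 b1] := b01 l.
      have bl : b l ^+ k @[k --> \oo] --> (0 : R).
        by apply: cvg_expr; rewrite ger0_norm.
      rewrite -[X in _ --> X](addr0 0) -{1}(mulr0 (-1)).
      apply: cvgD; first by apply: cvgM; [exact: cvg_cst|exact: bl].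
      by move: bl; rewrite -(cvg_shiftS (fun k => b l ^+ k)).
  move/cvg_norm; rewrite normr0; under eq_fun do rewrite scaleN1r addrC.
  suff -> : (fun k => `|iter k.+1 B (vec F) - iter k B (vec F)|) =
    (fun k => Hneg_norm (iter k.+1 Tle F - iter k Tle F)) by [].
  by apply/funext => k; rewrite vec_norm [vec (_ - _)]Hneg_vectorB -!vec_iter.
- by move=> F; rewrite !vec_norm vecT.
- move=> [F F0 TF]; move/eqP : F0; apply; apply/vec_eq0.
  apply: (represents_fixed rB b01).
  by rewrite -vecT TF scale1r.
Qed.

End main.

Theorem theorem3 (R : realType) (n : nat) (Omega : set 'rV[R]_n)
    (oO : open Omega) (bO : bounded_set Omega) (sO : smooth_boundary Omega)
    (A : linop (L2 (lebesgue_on oO)))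
    (ddA : densely_defined A) (uA : unbounded A) (pA : positive A)
    (saA : self_adjoint A) (dA : discrete_spectrum A)
    (E : resolution (L2 (lebesgue_on oO))) (EA : associated E A)
    (T : R) (T0 : 0 < T) :
  let tanhAT := calculus E (fun l => tanh (l * T)) in
  exists Tle : {linear Hneg E 2^-1 -> Hneg E 2^-1},
    [/\ extension (tanhAT \o tanhAT) Tle,
        op_positive (@Hneg_dot _ _ E 2^-1) Tle,
        op_self_adjoint (@Hneg_dot _ _ E 2^-1) Tle &
        injective Tle] /\
    [/\ regular_asymptotic (@Hneg_norm _ _ E 2^-1) Tle,
        nonexpansive (@Hneg_norm _ _ E 2^-1) Tle &
        ~ point_spectrum Tle 1].
Proof. exact: tanh_sqr_extension (@L2_complete _ _ _ _) pA EA T0. Qed.
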